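(* Let $(M,d)$ be a metric space and let $Y$ be a bounded subset of $M$. Let $\mathcal{N}$ be a $\sigma$-algebra of subsets of $Y$ containing all Borel subsets of $Y$, and let $\nu$ be a measure on $\mathcal{N}$ such that $\nu(B(x,r)\cap Y)<+\infty$ for all $x\in Y$, $r>0$. Let $\upsilon_Y\in]0,+\infty[$ and assume that $Y$ is upper $\upsilon_Y$-Ahlfors regular with respect to $Y$. Let $s_1,t_1\in[0,\upsilon_Y[$, $s_3\in[0,+\infty[$, $s_2'\in[0,\upsilon_Y[$, $s_2''\in[0,s_3]$ and $s_2\equiv s_2'+s_2''$. If $s_1+t_1=\upsilon_Y$ or $s_2'+t_1=\upsilon_Y$, assume furthermore that $Y$ is strongly upper $\upsilon_Y$-Ahlfors regular with respect to $Y$. Let $K_1\in\mathcal{K}_{s_1,s_2,s_3}(Y\times Y)$, $K_2\in\mathcal{K}_{t_1,Y\times Y}$, and let $K_3(x,y)\equiv\int_Y K_1(x,t)K_2(t,y)\,d\nu(t)$ for $x,y\in Y$, $x\neq y$. Set $m\equiv\min\{s_3-s_2'',\upsilon_Y-s_1,\upsilon_Y-t_1\}$ and, for $\epsilon\in]0,+\infty[$, \[ a_1(\epsilon)\equiv\begin{cases}0&\text{if } s_1+t_1<\upsilon_Y,\\ \epsilon&\text{if } s_1+t_1=\upsilon_Y,\\ s_1+t_1-\upsilon_Y&\text{if } s_1+t_1>\upsilon_Y,\end{cases}\qquad a_2(\epsilon)\equiv\begin{cases}\max\{s_1,t_1\}&\text{if } s_2'+t_1<\upsilon_Y,\\ \max\{\epsilon,s_1,t_1\}&\text{if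 } s_2'+t_1=\upsilon_Y,\\ \max\{s_2'+t_1-\upsilon_Y,s_1,t_1\}&\text{if } s_2'+t_1>\upsilon_Y.\end{cases} \] Then $K_3\in\mathcal{K}_{a_1(\epsilon),a_2(\epsilon),m}(Y\times Y)$ for every $\epsilon\in]0,+\infty[$ (in the cases where neither $a_1$ nor $a_2$ involves $\epsilon$, this is a single class).
   Context: For $\xi\in M$, $r>0$, $B(\xi,r)=\{\eta\in M: d(\xi,\eta)<r\}$, and $B(\xi,0)=\emptyset$. $Y$ is upper $\upsilon$-Ahlfors regular with respect to $Y$ if there exist $r_0\in]0,+\infty]$, $c_0\in]0,+\infty[$ with $\nu(B(x,r)\cap Y)\leq c_0r^{\upsilon}$ for all $x\in Y$, $r\in]0,r_0[$; strongly upper $\upsilon$-Ahlfors regular with respect to $Y$ if there exist $r_0\in]0,+\infty]$, $c_0\in]0,+\infty[$ with $\nu((B(x,r_2)\setminus B(x,r_1))\cap Y)\leq c_0(r_2^{\upsilon}-r_1^{\upsilon})$ for all $x\in Y$, $r_1,r_2\in[0,r_0[$, $r_1<r_2$. For $s\in\mathbb{R}$, $\mathcal{K}_{s,Y\times Y}$ is the set of continuous $K:\{(x,y)\in Y^2: x\neq y\}\to\mathbb{C}$ with $\sup_{x\neq y}|K(x,y)|d(x,y)^s<+\infty$. For $a_1,a_2,a_3\in\mathbb{R}$, $\mathcal{K}_{a_1,a_2,a_3}(Y\times Y)$ is the set of continuous $K:\{(x,y)\in Y^2:x\neq y\}\to\mathbb{C}$ such that $\sup\{d(x,y)^{a_1}|K(x,y)|: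 x,y\in Y,x\neq y\}<+\infty$ and $\sup\{\frac{d(x',y)^{a_2}}{d(x',x'')^{a_3}}|K(x',y)-K(x'',y)|: x',x''\in Y, x'\neq x'', y\in Y\setminus B(x',2d(x',x''))\}<+\infty$. *)

(* Defs.v *)
From HB Require Import structures.
From mathcomp Require Import all_boot all_order all_algebra.
From mathcomp Require Import all_classical all_reals all_analysis.
From mathcomp Require Import complex.
Set Implicit Arguments. Unset Strict Implicit. Unset Printing Implicit Defensive.
Import Order.TTheory GRing.Theory Num.Theory.
Local Open Scope classical_set_scope.
Local Open Scope ring_scope.

Section Defs.
Context {R : realType} {M : Type}.
Implicit Types (d : M -> M -> R) (Y : set M).

Definition is_metric d : Prop :=
  [/\ forall x y, 0 <= d x y,
      forall x y, d x y = 0 <-> x = y,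
      forall x y, d x y = d y x &
      forall x y z, d x z <= d x y + d y z].

(* open ball B(x,r) = {y : d(x,y) < r}; empty for r = 0 *)
Definition mball d (x : M) (r : R) : set M := [set y | d x y < r].

Definition d_open d (U : set M) : Prop :=
  forall x, U x -> exists2 r : R, 0 < r & mball d x r `<=` U.

Definition d_bounded d Y : Prop :=
  exists B : R, forall x y, Y x -> Y y -> d x y <= B.

Definition upper_Ahlfors d (nu : set M -> \bar R) Y (ups : R) : Prop :=
  exists r0 : \bar R, exists c0 : R,
    [/\ (0 < r0)%E, 0 < c0 &
      forall x r, Y x -> 0 < r -> (r%:E < r0)%E ->
        (nu (mball d x r `&` Y) <= (c0 * r `^ ups)%:E)%E].

Definition strongly_upper_Ahlfors d (nu : set M -> \bar R) Y (ups : R) : Prop :=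
  exists r0 : \bar R, exists c0 : R,
    [/\ (0 < r0)%E, 0 < c0 &
      forall x r1 r2, Y x -> 0 <= r1 -> r1 < r2 -> (r2%:E < r0)%E ->
        (nu ((mball d x r2 `\` mball d x r1) `&` Y)
           <= (c0 * (r2 `^ ups - r1 `^ ups))%:E)%E].

Definition offdiag_continuous d Y (K : M -> M -> R[i]) : Prop :=
  forall x y, Y x -> Y y -> x <> y ->
    forall e : R, 0 < e -> exists2 delta : R, 0 < delta &
      forall x' y', Y x' -> Y y' -> x' <> y' ->
        d x x' < delta -> d y y' < delta -> ComplexField.Normc.normc (K x' y' - K x y) < e.

Definition Kclass d Y (s : R) (K : M -> M -> R[i]) : Prop :=
  offdiag_continuous d Y K /\
  exists C : R, forall x y, Y x -> Y y -> x <> y ->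
    ComplexField.Normc.normc (K x y) * d x y `^ s <= C.

Definition Kclass3 d Y (a1 a2 a3 : R) (K : M -> M -> R[i]) : Prop :=
  [/\ offdiag_continuous d Y K,
      (exists C : R, forall x y, Y x -> Y y -> x <> y ->
         d x y `^ a1 * ComplexField.Normc.normc (K x y) <= C) &
      (exists C : R, forall x' x'' y, Y x' -> Y x'' -> x' <> x'' -> Y y ->
         ~ mball d x' (2 * d x' x'') y ->
         d x' y `^ a2 / d x' x'' `^ a3 * ComplexField.Normc.normc (K x' y - K x'' y) <= C)].

End Defs.

Definition cintegral {dd : measure_display} {T : measurableType dd} {R : realType}
  (mu : {measure set T -> \bar R}) (D : set T) (f : T -> R[i]) : R[i] :=
  (Rintegral mu D (fun t => @complex.Re R (f t)) +i* Rintegral mu D (fun t => @complex.Im R (f t)))%C.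

Definition cintegrable {dd : measure_display} {T : measurableType dd} {R : realType}
  (mu : {measure set T -> \bar R}) (D : set T) (f : T -> R[i]) : Prop :=
  mu.-integrable D (fun t => (@complex.Re R (f t))%:E) /\ mu.-integrable D (fun t => (@complex.Im R (f t))%:E).

Definition a1_exp {R : realType} (ups s1 t1 eps : R) : R :=
  if s1 + t1 < ups then 0 else if s1 + t1 == ups then eps else s1 + t1 - ups.

Definition a2_exp {R : realType} (ups s1 t1 s2' eps : R) : R :=
  if s2' + t1 < ups then Num.max s1 t1
  else if s2' + t1 == ups then Num.max eps (Num.max s1 t1)
  else Num.max (s2' + t1 - ups) (Num.max s1 t1).

(* Main.v *)
Require Import Defs.
From HB Require Import structures.
From mathcomp Require Import all_boot all_order all_algebra.
From mathcomp Require Import all_classical all_reals all_analysis.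
From mathcomp Require Import complex measurable_realfun ring lra.
Set Implicit Arguments. Unset Strict Implicit. Unset Printing Implicit Defensive.
Import Order.TTheory GRing.Theory Num.Theory.
Local Open Scope classical_set_scope.
Local Open Scope ring_scope.

(* Write w(p,s)(t) = d(p,t)^(-s). Summing over dyadic shells, upper Ahlfors
   regularity gives int_{B(x,r)} w(p,s) <= C r^(ups-s) for s < ups, for every pole p
   in Y and not only for the centre x, and int_{Y \ B(p,r)} w(p,s) <= C r^(ups-s) for
   s > ups. Since one of d(p,t), d(q,t) is at least d(p,q)/2, a product
   w(p,s1) w(q,s2) is dominated by a combination of w(p,s1) and w(q,s2), whence
   int_Y w(p,s1) w(q,s2) <= C d(p,q)^(-a1); this is the size estimate. For the
   Hoelder estimate, with r = d(x',x''), the ball B(x',2r) contributes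
   r^(ups-s1) and r^(ups-t1) by the local bound, and outside it the regularity of K1
   contributes r^(s3-s2'') times a product of exponents s2', t1. Joint continuity
   follows from the smallness of the integral near both poles and from dominated
   convergence away from them. *)

(** * Real powers and dyadic scales *)

Section real_powers.
Context {R : realType}.
Implicit Types u v D a b c : R.

(** A weaker singularity is traded for a stronger one at the price of a power of the diameter. The
    exponents may be negative, so the same inequality also lowers positive powers of [u]. *)
Lemma powRN_exchange u D a b : 0 < u -> u <= D -> a <= b ->
  u `^ (- a) <= D `^ (b - a) * u `^ (- b).
Proof.
move=> u0 uD ab.
have -> : u `^ (- a) = u `^ (b - a) * u `^ (- b).
  by rewrite -powRD ?(gt_eqF u0) ?implybT// addrAC subrr add0r.
rewrite ler_wpM2r ?powR_ge0// ge0_ler_powR ?subr_ge0// nnegrE ltW//.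
exact: lt_le_trans uD.
Qed.

Lemma ler_powRN u v a : 0 < u -> u <= v -> 0 <= a -> v `^ (- a) <= u `^ (- a).
Proof.
move=> u0 uv a0; have v0 := lt_le_trans u0 uv.
rewrite !powRN lef_pV2 ?posrE ?powR_gt0//.
by rewrite ge0_ler_powR// nnegrE ltW.
Qed.

Lemma powR_mulN u a b : 0 < u -> u `^ a * u `^ (- b) = u `^ (a - b).
Proof. by move=> u0; rewrite -powRD ?(gt_eqF u0) ?implybT. Qed.

Lemma powR_mul_le u a c K : 0 < u -> u `^ a * K <= c -> K <= c * u `^ (- a).
Proof. by move=> u0 h; rewrite powRN ler_pdivlMr ?powR_gt0// mulrC. Qed.


Lemma powRX (x a : R) k : 0 <= x -> (x ^+ k) `^ a = (x `^ a) ^+ k.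
Proof.
move=> x0; elim: k => [|k IH]; first by rewrite !expr0 powR1.
by rewrite !exprS powRM ?exprn_ge0// IH.
Qed.

(** Selects the dyadic shell that contains a point, with [v] a ratio of a distance and a radius. *)
Lemma dyadic_bracket (v : R) : 1 <= v -> exists k, 2 ^+ k <= v < 2 ^+ k.+1.
Proof.
move=> v1; have v0 := le_trans ler01 v1.
have /andP[nv vn] := truncn_itv v0.
have n0 : (0 < Num.truncn v)%N by rewrite truncn_gt0.
exists (trunc_log 2 (Num.truncn v)).
have /andP[h1 h2] := trunc_log_bounds (isT : (1 < 2)%N) n0.
apply/andP; split.
  by apply: le_trans nv; rewrite -natrX ler_nat.
by apply: (lt_le_trans vn); rewrite -natrX ler_nat.
Qed.

End real_powers.

Local Notation normc := ComplexField.Normc.normc.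

(** * The complex modulus against real and imaginary parts *)

Section complex_norm.
Context {R : realType}.
Implicit Types x y z : R[i].

Lemma normc_ge0 z : 0 <= normc z.
Proof. by case: z => a b; exact: sqrtr_ge0. Qed.

Lemma normc_mul x y : normc (x * y) = normc x * normc y.
Proof. exact: ComplexField.Normc.normcM. Qed.

Lemma normc_add_le x y : normc (x + y) <= normc x + normc y.
Proof. exact: (@le_normcD R x y). Qed.

Lemma normc_opp x : normc (- x) = normc x.
Proof. exact: (@normcN R x). Qed.

Lemma normc_sub_le x y : normc (x - y) <= normc x + normc y.
Proof. by rewrite -(normc_opp y) normc_add_le. Qed.

Lemma normc_Re z : `|complex.Re z| <= normc z.
Proof.
by case: z => a b /=; rewrite -sqrtr_sqr ler_wsqrtr// lerDl sqr_ge0.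
Qed.

Lemma normc_Im z : `|complex.Im z| <= normc z.
Proof.
by case: z => a b /=; rewrite -sqrtr_sqr ler_wsqrtr// lerDr sqr_ge0.
Qed.

Lemma normc_le_ReIm z : normc z <= `|complex.Re z| + `|complex.Im z|.
Proof.
case: z => a b /=; rewrite -[leRHS]ger0_norm ?addr_ge0// -sqrtr_sqr.
rewrite ler_wsqrtr// sqrrD !real_normK ?num_real// -addrA lerD2l.
by rewrite lerDr mulrn_wge0// mulr_ge0.
Qed.

End complex_norm.

(** * Comparison of integrals off null sets, and complex integrals *)

Section dominated_integrals.
Context {dd : measure_display} {T : measurableType dd} {R : realType}.
Variable mu : {measure set T -> \bar R}.
Local Open Scope ereal_scope.

(** Domination is asked only off a null set: the kernels are not controlled at their poles, and a
    negative [powR] power of [0] is a finite real. A single dominating function is handled by taking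
    [g2] zero and [b = 0]. *)
Lemma ge0_integral_le_lin2 (A N : set T) (f g1 g2 : T -> R) (a b c1 c2 : R) :
  measurable A -> measurable N -> mu N = 0 ->
  measurable_fun A f -> measurable_fun A g1 -> measurable_fun A g2 ->
  (forall t, 0 <= f t)%R -> (forall t, 0 <= g1 t)%R -> (forall t, 0 <= g2 t)%R ->
  (0 <= a)%R -> (0 <= b)%R ->
  \int[mu]_(t in A) (g1 t)%:E <= c1%:E -> \int[mu]_(t in A) (g2 t)%:E <= c2%:E ->
  (forall t, A t -> ~ N t -> f t <= a * g1 t + b * g2 t)%R ->
  \int[mu]_(t in A) (f t)%:E <= (a * c1 + b * c2)%:E.
Proof.
move=> mA mN N0 mf mg1 mg2 f0 g10 g20 a0 b0 i1 i2 fle.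
apply: (@le_trans _ _ (\int[mu]_(t in A) (a%:E * (g1 t)%:E + b%:E * (g2 t)%:E))).
  apply: ae_ge0_le_integral => //.
  - by move=> t _; rewrite lee_fin.
  - exact/measurable_EFinP.
  - by move=> t _; rewrite -!EFinM -EFinD lee_fin addr_ge0// mulr_ge0.
  - by apply/measurable_EFinP; apply: measurable_funD; apply: measurable_funM.
  exists N; split => // t /= h; apply: contrapT => nN; apply: h => At.
  by rewrite -!EFinM -EFinD lee_fin fle.
rewrite ge0_integralD//; first last.
- by apply/measurable_EFinP; apply: measurable_funM.
- by move=> t _; rewrite -EFinM lee_fin mulr_ge0.
- by apply/measurable_EFinP; apply: measurable_funM.
- by move=> t _; rewrite -EFinM lee_fin mulr_ge0.
rewrite !ge0_integralZl_EFin//; try exact/measurable_EFinP;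
  try by move=> t _; rewrite lee_fin.
by rewrite EFinD !EFinM leeD// lee_wpmul2l// lee_fin.
Qed.

Lemma ge0_integral_le_setU (A A1 A2 : set T) (f : T -> R) :
  measurable A -> measurable A1 -> measurable A2 -> A `<=` A1 `|` A2 ->
  measurable_fun (A1 `|` A2) f -> (forall t, 0 <= f t)%R ->
  \int[mu]_(t in A) (f t)%:E <=
    \int[mu]_(t in A1) (f t)%:E + \int[mu]_(t in A2) (f t)%:E.
Proof.
move=> mA mA1 mA2 AU mf f0.
have f0' (B : set T) t : B t -> 0 <= (f t)%:E by rewrite lee_fin.
have mf' : measurable_fun (A1 `|` A2) (EFin \o f) by exact/measurable_EFinP.
apply: (@le_trans _ _ (\int[mu]_(t in A1 `|` A2) (f t)%:E)).
  by apply: ge0_subset_integral => //; [exact: measurableU|exact: f0'].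
have E : A1 `|` A2 = A1 `|` (A2 `\` A1) by rewrite setDE setUIr setUv setIT.
rewrite E ge0_integral_setU//; first last.
- by apply/disj_setPS => t [] ? [].
- exact: f0'.
- by rewrite -E.
- exact: measurableD.
rewrite leeD2l//; apply: ge0_subset_integral => //.
- exact: measurableD.
- apply: (measurable_funS _ _ mf'); [exact: measurableU|exact: subsetUr].
- exact: f0'.
Qed.

(* [f] is bounded by the series [\sum_k b k * \1_(B k)], integrated termwise. *)
Lemma ge0_integral_le_geometric (A N : set T) (B : nat -> set T) (f : T -> R)
    (b : nat -> R) (C z : R) :
  measurable A -> measurable N -> mu N = 0 ->
  (forall k, measurable (B k)) -> measurable_fun A f -> (forall t, 0 <= f t)%R ->
  (forall k, 0 <= b k)%R -> (0 <= z < 1)%R -> (0 <= C)%R ->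
  (forall k, (b k)%:E * mu (B k) <= (C * z ^+ k)%:E) ->
  (forall t, A t -> ~ N t -> exists2 k, B k t & (f t <= b k)%R) ->
  \int[mu]_(t in A) (f t)%:E <= (C / (1 - z))%:E.
Proof.
move=> mA mN N0 mB mf f0 b0 /andP[z0 z1] C0 bm fle.
pose g k t : \bar R := (b k)%:E * (\1_(B k) t)%:E.
have g0 k t : 0 <= g k t by rewrite /g -EFinM lee_fin mulr_ge0.
have mg k : measurable_fun A (g k).
  apply/measurable_EFinP; exact: measurable_funM.
apply: (@le_trans _ _ (\int[mu]_(t in A) \sum_(k <oo) g k t)).
  apply: ae_ge0_le_integral => //.
  - by move=> t _; rewrite lee_fin.
  - exact/measurable_EFinP.
  - by move=> t _; apply: nneseries_ge0.
  - exact: ge0_emeasurable_sum.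
  exists N; split => // t /= h; apply: contrapT => nN; apply: h => At.
  have [k Bk fk] := fle t At nN.
  rewrite (@nneseriesD1 _ (g ^~ t) k xpredT)//.
  apply: (@le_trans _ _ (g k t)); last by rewrite leeDl// nneseries_ge0.
  by rewrite /g indicE mem_set// mule1 lee_fin.
rewrite integral_nneseries//.
apply: (@le_trans _ _ (\sum_(k <oo) (C * z ^+ k)%:E)).
  apply: lee_nneseries => [k _ _|k _]; first exact: integral_ge0.
  apply: le_trans (bm k).
  rewrite ge0_integralZl_EFin// ?integral_indic//; last first.
    by apply/measurable_EFinP; exact: measurable_indic.
  rewrite lee_wpmul2l ?lee_fin// le_measure ?inE//.
  exact: measurableI.
have cg := @cvg_geometric_series R C z.
rewrite le_eqVlt; apply/orP; left; apply/eqP.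
apply: cvg_lim => //.
have -> : (fun n => \sum_(0 <= k < n) (C * z ^+ k)%:E) =
          EFin \o series (geometric C z).
  by apply/funext => n /=; rewrite sumEFin.
by apply: cvg_EFin; [exact: nearW|apply: cg; rewrite ger0_norm].
Qed.

Section complex_integrals.
Variable Y : set T.
Hypothesis mY : measurable Y.
Implicit Types f g : T -> R[i].

Definition cmeasurable f : Prop :=
  measurable_fun Y (fun t => complex.Re (f t)) /\
  measurable_fun Y (fun t => complex.Im (f t)).

Lemma cmeasurable_mul f g : cmeasurable f -> cmeasurable g ->
  cmeasurable (fun t => (f t * g t)%R).
Proof.
move=> [f1 f2] [g1 g2]; split.
  rewrite (_ : (fun t => _) = (fun t => complex.Re (f t) * complex.Re (g t)
    - complex.Im (f t) * complex.Im (g t))%R).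
    by apply: measurable_funB; apply: measurable_funM.
  by apply/funext => t; case: (f t); case: (g t).
rewrite (_ : (fun t => _) = (fun t => complex.Re (f t) * complex.Im (g t)
  + complex.Im (f t) * complex.Re (g t))%R).
  by apply: measurable_funD; apply: measurable_funM.
by apply/funext => t; case: (f t); case: (g t).
Qed.

Lemma cmeasurable_sub f g : cmeasurable f -> cmeasurable g ->
  cmeasurable (fun t => (f t - g t)%R).
Proof.
move=> [f1 f2] [g1 g2]; split.
  rewrite (_ : (fun t => _) = (fun t => complex.Re (f t) - complex.Re (g t))%R).
    exact: measurable_funB.
  by apply/funext => t; case: (f t); case: (g t).
rewrite (_ : (fun t => _) = (fun t => complex.Im (f t) - complex.Im (g t))%R).
  exact: measurable_funB.
by apply/funext => t; case: (f t); case: (g t).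
Qed.

Lemma cmeasurable_normc f : cmeasurable f -> measurable_fun Y (fun t => normc (f t)).
Proof.
move=> [f1 f2]; rewrite (_ : (fun t => _) =
    (fun t => (complex.Re (f t) ^+ 2 + complex.Im (f t) ^+ 2) `^ 2^-1)%R).
  apply: (measurableT_comp (measurable_powR 2^-1)).
  by apply: measurable_funD; apply: measurable_funX.
by apply/funext => t; case: (f t) => a b /=; rewrite powR12_sqrt// addr_ge0 ?sqr_ge0.
Qed.

Lemma cintegrable_le f (c : R) : cmeasurable f ->
  \int[mu]_(t in Y) (normc (f t))%:E <= c%:E -> cintegrable mu Y f.
Proof.
move=> mf fc; have [f1 f2] := mf.
have mN := cmeasurable_normc mf.
split; apply/integrableP; split; try exact/measurable_EFinP.
  apply: (@le_lt_trans _ _ c%:E); rewrite ?ltry//; apply: le_trans fc.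
  apply: ge0_le_integral => //.
  - by apply/measurable_EFinP; apply: measurableT_comp.
  - exact/measurable_EFinP.
  by move=> t _; rewrite lee_fin normc_Re.
apply: (@le_lt_trans _ _ c%:E); rewrite ?ltry//; apply: le_trans fc.
apply: ge0_le_integral => //.
- by apply/measurable_EFinP; apply: measurableT_comp.
- exact/measurable_EFinP.
by move=> t _; rewrite lee_fin normc_Im.
Qed.

Lemma normr_Rintegral_le (h g : T -> R) (c : R) : measurable_fun Y g ->
  mu.-integrable Y (EFin \o h) -> (forall t, `|h t| <= g t)%R ->
  \int[mu]_(t in Y) (g t)%:E <= c%:E -> (`|Rintegral mu Y h| <= c)%R.
Proof.
move=> mg ih hg gc; rewrite -lee_fin EFin_normr_Rintegral//.
apply: le_trans gc; apply: le_trans (le_abse_integral mu mY (measurable_int _ ih)) _.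
apply: ge0_le_integral => //.
- by apply: measurableT_comp => //; exact: measurable_int ih.
- exact/measurable_EFinP.
by move=> t _; rewrite lee_fin.
Qed.

(** The factor 2 comes from bounding the real and imaginary parts separately, each by the integral
    of the modulus. *)
Lemma normc_cintegral_le f (c : R) : cmeasurable f ->
  \int[mu]_(t in Y) (normc (f t))%:E <= c%:E -> (normc (cintegral mu Y f) <= 2 * c)%R.
Proof.
move=> mf fc; have [i1 i2] := cintegrable_le mf fc.
have mN := cmeasurable_normc mf.
rewrite mulr_natl mulr2n; apply: le_trans (normc_le_ReIm _) _ => /=.
rewrite lerD//.
  by apply: normr_Rintegral_le mN i1 _ fc => t; exact: normc_Re.
by apply: normr_Rintegral_le mN i2 _ fc => t; exact: normc_Im.
Qed.

Lemma cintegralB f g : cintegrable mu Y f -> cintegrable mu Y g ->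
  cintegral mu Y (fun t => f t - g t)%R = (cintegral mu Y f - cintegral mu Y g)%R.
Proof.
move=> [f1 f2] [g1 g2]; rewrite /cintegral.
rewrite (_ : Rintegral _ _ _ =
    Rintegral mu Y (fun t => complex.Re (f t) - complex.Re (g t))%R); last first.
  by apply: eq_Rintegral => t _; case: (f t); case: (g t).
rewrite (_ : Rintegral mu Y (fun t => complex.Im (f t - g t)%R) =
    Rintegral mu Y (fun t => complex.Im (f t) - complex.Im (g t))%R); last first.
  by apply: eq_Rintegral => t _; case: (f t); case: (g t).
by rewrite !RintegralB.
Qed.

End complex_integrals.
End dominated_integrals.

(** * Measurability derived from the metric *)

Section metric_measure.
Context {dd : measure_display} {M : measurableType dd} {R : realType}.
Variables (d : M -> M -> R) (Y : set M) (nu : {measure set M -> \bar R}).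
Hypothesis d_metric : is_metric d.
Hypothesis borel_Y : forall U : set M, d_open d U -> measurable (U `&` Y).

Let d_ge0 x y : 0 <= d x y. Proof. by have [h _ _ _] := d_metric. Qed.
Let d_sym x y : d x y = d y x. Proof. by have [_ _ h _] := d_metric. Qed.
Let d_tri y x z : d x z <= d x y + d y z. Proof. by have [_ _ _ h] := d_metric. Qed.
Let d_xx x : d x x = 0. Proof. by have [_ h _ _] := d_metric; apply/h. Qed.
Let d_gt0 x y : x <> y -> 0 < d x y.
Proof.
move=> xy; rewrite lt_neqAle d_ge0 andbT eq_sym; apply/eqP => h; apply: xy.
by have [_ e _ _] := d_metric; apply/e.
Qed.

Lemma d_open_mball p r : d_open d (mball d p r).
Proof.
move=> x /= xr; exists (r - d p x); rewrite ?subr_gt0// => y.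
by rewrite /mball/= ltrBrDl; apply: le_lt_trans; exact: d_tri.
Qed.

Lemma measurable_carrier : measurable Y.
Proof.
by rewrite -(setTI Y); apply: borel_Y => x _; exists 1.
Qed.

Lemma measurable_mball p r : measurable (mball d p r `&` Y).
Proof. exact/borel_Y/d_open_mball. Qed.

Lemma measurable_setD_mball p r : measurable (Y `\` mball d p r).
Proof.
have -> : Y `\` mball d p r = Y `\` (mball d p r `&` Y).
  by rewrite setDIr setDv setU0.
exact: measurableD measurable_carrier (measurable_mball p r).
Qed.

(** Superlevel sets are traces on [Z] of open sets, and open upper rays generate the Borel sets of
    the line. Semicontinuity is relative to [Z], so that a pole can be removed beforehand. *)
Lemma lsc_measurable_fun (Z : set M) (f : M -> R) : measurable Z -> Z `<=` Y ->
  (forall t a, Z t -> a < f t -> exists2 e, 0 < e &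
     forall t', Z t' -> d t t' < e -> a < f t') ->
  measurable_fun Z f.
Proof.
move=> mZ ZY lsc _; apply: (measurability _ (RGenOInfty.measurableE R)) => //.
move=> _ [_ [a ->] <-].
(* [borel_Y] speaks of open sets of the whole space, so [U] is built as a union of open balls of
   [M]; inside [Z] it cuts out exactly the superlevel set. *)
pose U := [set z | exists t e, [/\ Z t, d t z < e &
  forall t', Z t' -> d t t' < e -> a < f t']].
have -> : Z `&` f @^-1` `]a, +oo[ = Z `&` (U `&` Y).
  apply/seteqP; split => z /=; rewrite in_itv/= andbT.
    move=> [Zz az]; split => //; split; last exact: ZY.
    have [e e0 he] := lsc _ _ Zz az.
    by exists z, e; rewrite d_xx.
  by move=> [Zz [[t [e [_ tz he]]] _]]; split => //; exact: he.
apply: measurableI => //; apply: borel_Y => z [t [e [Zt tz he]]].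
exists (e - d t z); rewrite ?subr_gt0// => y /= zy.
exists t, e; split => //.
by move: zy; rewrite /mball/= ltrBrDl; apply: le_lt_trans; exact: d_tri.
Qed.

Lemma measurable_dist q : measurable_fun Y (d q).
Proof.
apply: lsc_measurable_fun => //; first exact: measurable_carrier.
move=> t a _ at_; exists (d q t - a); rewrite ?subr_gt0// => t' _.
rewrite ltrBrDl -ltrBrDr => h; apply: (lt_le_trans h).
by rewrite lerBlDr (d_sym t) d_tri.
Qed.

Lemma measurable_dist_powR q s : measurable_fun Y (fun t => d q t `^ s).
Proof.
exact: (measurableT_comp (measurable_powR s) (measurable_dist q)).
Qed.

Lemma measurable_point p : Y p -> measurable [set p].
Proof.
move=> Yp.
have -> : [set p] = Y `\` ([set x | x <> p] `&` Y).
  apply/seteqP; split => x /=; first by move=> ->; split => // -[].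
  by move=> [Yx h]; apply: contrapT => xp; exact: h.
apply: measurableD; first exact: measurable_carrier.
apply: borel_Y => x /= xp; exists (d x p); first exact: d_gt0.
by move=> y xy yp; move: xy; rewrite yp /mball/= ltxx.
Qed.

(** * Integrals of distance weights under Ahlfors regularity *)

Section ahlfors.
Variables (ups c D : R).
Hypothesis ups_gt0 : 0 < ups.
Hypothesis c_gt0 : 0 < c.
Hypothesis ahlfors : forall x r, Y x -> 0 < r ->
  (nu (mball d x r `&` Y) <= (c * r `^ ups)%:E)%E.
Hypothesis D_gt0 : 0 < D.
Hypothesis diam : forall x y, Y x -> Y y -> d x y <= D.

Lemma measure_point p : Y p -> nu [set p] = 0%E.
Proof.
move=> Yp; have mp := measurable_point Yp.
apply/eqP; rewrite eq_le measure_ge0 andbT; apply/lee_addgt0Pr => e e0.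
rewrite add0e.
(* The radius at which the Ahlfors bound for the ball equals [e]. *)
pose r := (e / c) `^ (ups^-1).
have r0 : 0 < r by rewrite powR_gt0// divr_gt0.
have -> : e = c * r `^ ups.
  rewrite /r -powRrM mulVf ?gt_eqF// powRr1 ?divr_ge0 ?ltW//.
  by rewrite mulrC divfK// gt_eqF.
apply: le_trans (ahlfors Yp r0).
apply: le_measure; rewrite ?inE//; first exact: measurable_mball.
by move=> _ /= ->; split => //; rewrite /mball/= d_xx.
Qed.

(** The weight on a shell is at most its value at the inner radius, and the measure is at most that
    of the outer ball, so the contributions form a geometric series whose ratio is [lam] to the
    power [ups - s]. Leaving [lam] free covers shells shrinking to the pole and shells growing away
    from it; the pole itself lies in no shell but is null. *)
Lemma integral_shells (lam k1 k2 s r : R) q A : Y q -> measurable A -> A `<=` Y ->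
  0 < lam -> lam `^ (ups - s) < 1 -> 0 < k1 -> 0 < k2 -> 0 <= s -> 0 < r ->
  (forall t, A t -> 0 < d q t -> exists k,
     r * k1 * lam ^+ k <= d q t < r * k2 * lam ^+ k) ->
  (\int[nu]_(t in A) (d q t `^ (- s))%:E <=
    (c * k1 `^ (- s) * k2 `^ ups / (1 - lam `^ (ups - s)) * r `^ (ups - s))%:E)%E.
Proof.
move=> Yq mA AY lam0 lam1 k10 k20 s0 r0 shell.
pose h k := lam ^+ k; have h0 k : 0 < h k by rewrite exprn_gt0.
apply: le_trans (_ : (_ <= (c * k1 `^ (- s) * k2 `^ ups * r `^ (ups - s)
  / (1 - lam `^ (ups - s)))%:E)%E) _; last first.
  by rewrite lee_fin mulrAC.
apply: (@ge0_integral_le_geometric _ _ _ nu A [set q]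
  (fun k => mball d q (r * k2 * h k) `&` Y) _ (fun k => (r * k1 * h k) `^ (- s))).
- by [].
- exact: measurable_point.
- exact: measure_point.
- by move=> k; exact: measurable_mball.
- apply: measurable_funS (measurable_dist_powR q (- s)) => //.
  exact: measurable_carrier.
- by move=> t; exact: powR_ge0.
- by move=> k; exact: powR_ge0.
- by rewrite powR_ge0.
- by rewrite !mulr_ge0 ?powR_ge0 ?ltW.
- move=> k.
  have rk0 : 0 < r * k2 * h k by rewrite !mulr_gt0.
  apply: le_trans (_ : (_ <= ((r * k1 * h k) `^ (- s))%:E *
     (c * (r * k2 * h k) `^ ups)%:E)%E) _.
    by rewrite lee_wpmul2l ?lee_fin ?powR_ge0// ahlfors.
  rewrite -EFinM lee_fin -powRX ?(ltW lam0)// -/(h k).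
  rewrite !powRM ?mulr_ge0 ?(ltW r0, ltW k10, ltW k20, ltW (h0 k))// -!powR_mulN ?h0//.
  by rewrite le_eqVlt; apply/orP; left; apply/eqP; ring.
move=> t At /= tq.
have dt : 0 < d q t by apply: d_gt0 => e; exact: tq.
have [k /andP[l u]] := shell t At dt.
exists k; first by split => //; exact: AY.
by apply: ler_powRN => //; rewrite !mulr_gt0.
Qed.

Lemma powR_half_lt1 a : 0 < a -> (2^-1 : R) `^ a < 1.
Proof.
move=> a0; rewrite -[ltRHS](_ : 1 `^ a = 1); last by rewrite powR1.
by apply: gt0_ltr_powR; rewrite ?nnegrE//; lra.
Qed.

Lemma integral_centered_ball s : 0 <= s < ups -> exists2 C, 0 <= C &
  forall q r, Y q -> 0 < r ->
  (\int[nu]_(t in mball d q r `&` Y) (d q t `^ (- s))%:E <= (C * r `^ (ups - s))%:E)%E.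
Proof.
move=> /andP[s0 su].
have z1 : (2^-1 : R) `^ (ups - s) < 1 by rewrite powR_half_lt1// subr_gt0.
(* The constant is found by unification with the one in [integral_shells]; its sign is checked at
   the end. *)
eexists; last first.
  move=> q r Yq r0.
  apply: (integral_shells (lam := 2^-1) (k1 := 2^-1) (k2 := 2)) => //.
  - exact: measurable_mball.
  - move=> t [qt _] qt0.
    (* Bracketing [r / d q t] gives only a non-strict upper bound on [d q t]; taking [k2 = 2] rather
       than 1 makes it strict, as the open balls require. *)
    have v1 : 1 <= r / d q t by rewrite ler_pdivlMr// mul1r ltW.
    have [k /andP[]] := dyadic_bracket v1.
    have h0 : 0 < 2 ^+ k :> R by rewrite exprn_gt0.
    rewrite exprS ler_pdivlMr// ltr_pdivrMr// => l u.
    exists k; rewrite exprVn ler_pdivrMr// ltr_pdivlMr//; apply/andP; split; nra.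
by rewrite !mulr_ge0 ?powR_ge0 ?invr_ge0 ?subr_ge0 ?(ltW z1) ?(ltW c_gt0).
Qed.

(** The outward counterpart: with [lam = 2] the series converges because [s] exceeds [ups]. *)
Lemma integral_ball_compl s : ups < s -> exists2 C, 0 <= C &
  forall q r, Y q -> 0 < r ->
  (\int[nu]_(t in Y `\` mball d q r) (d q t `^ (- s))%:E <= (C * r `^ (ups - s))%:E)%E.
Proof.
move=> su; have s0 := ltW (lt_trans ups_gt0 su).
have z1 : (2 : R) `^ (ups - s) < 1.
  rewrite -opprB powRN invf_lt1 ?powR_gt0// -[ltLHS](_ : 1 `^ (s - ups) = 1).
    by apply: gt0_ltr_powR; rewrite ?subr_gt0// ?nnegrE//; lra.
  by rewrite powR1.
eexists; last first.
  move=> q r Yq r0.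
  apply: (integral_shells (lam := 2) (k1 := 1) (k2 := 2)) => //.
  - exact: measurable_setD_mball.
  - move=> t [_ /negP]; rewrite -leNgt => qt qt0.
    have v1 : 1 <= d q t / r by rewrite ler_pdivlMr// mul1r.
    have [k /andP[]] := dyadic_bracket v1.
    rewrite exprS ler_pdivlMr// ltr_pdivrMr// => l u.
    exists k; apply/andP; split; nra.
by rewrite !mulr_ge0 ?powR_ge0 ?invr_ge0 ?subr_ge0 ?(ltW z1) ?(ltW c_gt0).
Qed.

(** Inside the ball of the same radius around [q] the centred bound applies; on the rest [d q t] is
    at least [r], so the weight is bounded and the measure of the ball around [p] suffices. *)
Lemma integral_ball s : 0 <= s < ups -> exists2 C, 0 <= C &
  forall p q r, Y p -> Y q -> 0 < r ->
  (\int[nu]_(t in mball d p r `&` Y) (d q t `^ (- s))%:E <= (C * r `^ (ups - s))%:E)%E.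
Proof.
move=> su; have /andP[s0 su'] := su.
have [C C0 HC] := integral_centered_ball su.
exists (C + c); first by rewrite addr_ge0// ltW.
move=> p q r Yp Yq r0.
have mB := measurable_mball p r.
have mf := measurable_dist_powR q (- s).
have f0 t : 0 <= d q t `^ (- s) by exact: powR_ge0.
have mD := measurableD mB (measurable_mball q r).
apply: le_trans (ge0_integral_le_setU nu mB (measurable_mball q r) mD _ _ f0) _.
- move=> t [pt Yt]; have [qt|qt] := pselect (mball d q r t); first by left.
  by right; split => // -[].
- apply: measurable_funS mf; first exact: measurable_carrier.
  by move=> t [[]|[[]]].
rewrite mulrDl EFinD leeD//; first exact: HC.
apply: le_trans (_ : (_ <= (1 * (c * r `^ (ups - s)) + 0 * 0)%:E)%E) _; last first.
  by rewrite mul1r mul0r addr0.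
pose A := (mball d p r `&` Y) `\` (mball d q r `&` Y).
apply: (@ge0_integral_le_lin2 _ _ _ nu A set0 _ (cst (r `^ (- s))) (cst 0)) => //.
- apply: measurable_funS mf; first exact: measurable_carrier.
  by move=> t [[]].
- by move=> t; exact: powR_ge0.
- rewrite [leLHS](integral_cst nu mD (r `^ (- s))%:E) -powR_mulN//.
  rewrite (_ : c * _ = r `^ (- s) * (c * r `^ ups)); last by ring.
  rewrite EFinM lee_wpmul2l ?lee_fin ?powR_ge0//.
  apply: le_trans (ahlfors Yp r0); apply: le_measure; rewrite ?inE.
  + exact: mD.
  + exact: mB.
  + by apply: subDsetl.
- by rewrite integral0.
move=> t [[pt Yt] qt] _ /=; rewrite mul1r mul0r addr0.
apply: ler_powRN => //; rewrite leNgt; apply/negP => h; exact: qt.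
Qed.

(** By the triangle inequality [t] is at distance at least [rho / 2] from one of the poles, and the
    weight of that pole is replaced by its value at this distance. Using a lower bound [rho] instead
    of [d p q] lets one constant serve several pairs of poles. *)
Lemma mul_dist_powRN_le p q t rho s1 s2 : 0 < rho -> rho <= d p q ->
  0 <= s1 -> 0 <= s2 ->
  d p t `^ (- s1) * d q t `^ (- s2) <=
    (rho / 2) `^ (- s2) * d p t `^ (- s1) + (rho / 2) `^ (- s1) * d q t `^ (- s2).
Proof.
move=> rho0 rho_le s10 s20.
have h0 : 0 < rho / 2 by rewrite divr_gt0.
have [pt|pt] := leP (rho / 2) (d p t).
  by rewrite ler_wpDl ?mulr_ge0 ?powR_ge0// ler_wpM2r ?powR_ge0// ler_powRN.
rewrite ler_wpDr ?mulr_ge0 ?powR_ge0// mulrC ler_wpM2r ?powR_ge0// ler_powRN//.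
have := d_tri t p q; rewrite (d_sym t q); lra.
Qed.

Lemma integral_ball_pair s1 s2 : 0 <= s1 < ups -> 0 <= s2 < ups ->
  exists2 C, 0 <= C & forall x p q rho r, Y x -> Y p -> Y q ->
    0 < rho -> rho <= d p q -> 0 < r ->
  (\int[nu]_(t in mball d x r `&` Y) (d p t `^ (- s1) * d q t `^ (- s2))%:E <=
   (C * (rho `^ (- s2) * r `^ (ups - s1) + rho `^ (- s1) * r `^ (ups - s2)))%:E)%E.
Proof.
move=> s1u s2u; have [C1 C10 H1] := integral_ball s1u.
have [C2 C20 H2] := integral_ball s2u.
have /andP[s10 _] := s1u; have /andP[s20 _] := s2u.
pose k1 := (2^-1 : R) `^ (- s1); pose k2 := (2^-1 : R) `^ (- s2).
have k10 : 0 <= k1 by exact: powR_ge0.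
have k20 : 0 <= k2 by exact: powR_ge0.
exists (k2 * C1 + k1 * C2); first by rewrite addr_ge0 ?mulr_ge0.
move=> x p q rho r Yx Yp Yq rho0 rho_le r0.
have mB := measurable_mball x r.
have mw z s : measurable_fun (mball d x r `&` Y) (fun t => d z t `^ s).
  apply: measurable_funS (measurable_dist_powR z s).
    exact: measurable_carrier.
  exact: subIsetr.
have bound := ge0_integral_le_lin2 (N := set0) mB measurable0 (measure0 nu)
  (measurable_funM (mw p (- s1)) (mw q (- s2))) (mw p (- s1)) (mw q (- s2))
  (fun t => mulr_ge0 (powR_ge0 _ _) (powR_ge0 _ _))
  (fun t => powR_ge0 _ _) (fun t => powR_ge0 _ _)
  (powR_ge0 (rho / 2) (- s2)) (powR_ge0 (rho / 2) (- s1))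
  (H1 x p r Yx Yp r0) (H2 x q r Yx Yq r0)
  (fun t _ _ => mul_dist_powRN_le t rho0 rho_le s10 s20).
apply: le_trans bound _; rewrite lee_fin !(powRM _ (ltW rho0))// -/k1 -/k2.
set a := rho `^ _; set b := rho `^ _; set u := r `^ _; set v := r `^ _.
have [a0 b0 u0 v0] : [/\ 0 <= a, 0 <= b, 0 <= u & 0 <= v] by split; exact: powR_ge0.
have := mulr_ge0 (mulr_ge0 k20 C10) (mulr_ge0 b0 v0).
have := mulr_ge0 (mulr_ge0 k10 C20) (mulr_ge0 a0 u0).
lra.
Qed.

Let measurable_pair p q s1 s2 :
  measurable_fun Y (fun t => d p t `^ s1 * d q t `^ s2).
Proof. by apply: measurable_funM; exact: measurable_dist_powR. Qed.

(** The diameter bound is doubled because balls are open and the distance [D] may be attained. *)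
Let carrier_ball p : Y p -> mball d p (2 * D) `&` Y = Y.
Proof.
move=> Yp; apply/setIidPr => t Yt; rewrite /mball/=.
by apply: le_lt_trans (diam Yp Yt) _; rewrite ltr_pMl// ltr1n.
Qed.

(** The carrier is cut at the ball of radius [2 * d p q] around [p]. Inside, the two-pole bound
    scales correctly; outside, [d q t] is at least half of [d p t], and the product is controlled by
    one weight of exponent [s1 + s2], integrable away from its pole. *)
Lemma integral_pair_gt s1 s2 : 0 <= s1 < ups -> 0 <= s2 < ups -> ups < s1 + s2 ->
  exists2 C, 0 <= C & forall p q, Y p -> Y q -> p <> q ->
  (\int[nu]_(t in Y) (d p t `^ (- s1) * d q t `^ (- s2))%:E <=
     (C * d p q `^ (- (s1 + s2 - ups)))%:E)%E.
Proof.
move=> s1u s2u s12; have [C1 C10 H1] := integral_ball_pair s1u s2u.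
have [C2 C20 H2] := integral_ball_compl s12.
have /andP[s10 _] := s1u; have /andP[s20 _] := s2u.
(* [k1], [k2] and [k3] absorb the factor 2 in the radius, and [k4] the halving of [d p t]. *)
pose k1 := (2 : R) `^ (ups - s1); pose k2 := (2 : R) `^ (ups - s2).
pose k3 := (2 : R) `^ (ups - (s1 + s2)); pose k4 := (2^-1 : R) `^ (- s2).
exists (C1 * (k1 + k2) + k4 * (C2 * k3)).
  by rewrite addr_ge0 ?mulr_ge0 ?addr_ge0 ?powR_ge0.
move=> p q Yp Yq pq; have rho0 := d_gt0 pq.
have r0 : 0 < 2 * d p q by rewrite mulr_gt0.
have mB := measurable_mball p (2 * d p q).
have mC := measurable_setD_mball p (2 * d p q).
have w0 t : 0 <= d p t `^ (- s1) * d q t `^ (- s2) by rewrite mulr_ge0 ?powR_ge0.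
have YU : Y = (mball d p (2 * d p q) `&` Y) `|` (Y `\` mball d p (2 * d p q)).
  by rewrite setIC setUIDK.
apply: le_trans (ge0_integral_le_setU nu measurable_carrier mB mC _ _ w0) _.
- by rewrite -YU.
- by rewrite -YU; exact: measurable_pair.
rewrite (mulrDl (C1 * (k1 + k2))) EFinD leeD//.
  apply: le_trans (H1 p p q (d p q) _ Yp Yp Yq rho0 (lexx _) r0) _.
  have e1 : d p q `^ (- s2) * d p q `^ (ups - s1) = d p q `^ (- (s1 + s2 - ups)).
    by rewrite mulrC powR_mulN//; congr (_ `^ _); ring.
  have e2 : d p q `^ (- s1) * d p q `^ (ups - s2) = d p q `^ (- (s1 + s2 - ups)).
    by rewrite mulrC powR_mulN//; congr (_ `^ _); ring.
  rewrite lee_fin !(powRM _ _ (ltW rho0))// -/k1 -/k2 (mulrCA _ k1) (mulrCA _ k2).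
  by rewrite e1 e2 -mulrDl mulrA.
have mw z s : measurable_fun (Y `\` mball d p (2 * d p q)) (fun t => d z t `^ s).
  apply: measurable_funS (measurable_dist_powR z s).
    exact: measurable_carrier.
  exact: subDsetl.
apply: le_trans (_ : (_ <= (k4 * (C2 * (2 * d p q) `^ (ups - (s1 + s2))) + 0 * 0)%:E)%E) _.
  apply: (@ge0_integral_le_lin2 _ _ _ nu _ set0 _
    (fun t => d p t `^ (- (s1 + s2))) (cst 0)) => //.
  - by apply: measurable_funM.
  - by move=> t; exact: powR_ge0.
  - exact: powR_ge0.
  - exact: H2.
  - by rewrite integral0.
  move=> t [Yt /negP]; rewrite -leNgt => pt _; rewrite mul0r addr0.
  have pt0 : 0 < d p t by apply: lt_le_trans pt.
  have : d q t `^ (- s2) <= (2^-1 * d p t) `^ (- s2).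
    by apply: ler_powRN => //; [lra|have := d_tri q p t; lra].
  rewrite powRM ?(ltW pt0) ?invr_ge0// -/k4.
  move=> /(ler_wpM2l (powR_ge0 (d p t) (- s1))) /le_trans; apply.
  by rewrite mulrCA powR_mulN// opprD.
rewrite lee_fin powRM ?(ltW rho0)// -/k3 mul0r addr0 !mulrA.
by rewrite opprB.
Qed.

Lemma integral_carrier s : 0 <= s < ups -> exists2 C, 0 <= C &
  forall q, Y q -> (\int[nu]_(t in Y) (d q t `^ (- s))%:E <= C%:E)%E.
Proof.
move=> su; have [C C0 HC] := integral_centered_ball su.
exists (C * (2 * D) `^ (ups - s)); first by rewrite mulr_ge0 ?powR_ge0.
by move=> q Yq; rewrite -{1}(carrier_ball Yq) HC// mulr_gt0.
Qed.

(** The product is at most the weight of total exponent [s1 + s2] at whichever pole is nearer to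
    [t], and this weight is still integrable. *)
Lemma integral_pair_lt s1 s2 : 0 <= s1 -> 0 <= s2 -> s1 + s2 < ups ->
  exists2 C, 0 <= C & forall p q, Y p -> Y q -> p <> q ->
  (\int[nu]_(t in Y) (d p t `^ (- s1) * d q t `^ (- s2))%:E <= C%:E)%E.
Proof.
move=> s10 s20 s12.
have [|C C0 HC] := @integral_carrier (s1 + s2); first by rewrite addr_ge0.
exists (1 * C + 1 * C); first by rewrite mul1r addr_ge0.
move=> p q Yp Yq pq.
apply: (@ge0_integral_le_lin2 _ _ _ nu _ ([set p] `|` [set q]) _
  (fun t => d p t `^ (- (s1 + s2))) (fun t => d q t `^ (- (s1 + s2)))) => //.
- exact: measurable_carrier.
- by apply: measurableU; exact: measurable_point.
- by rewrite measureU0 ?measure_point//; exact: measurable_point.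
- exact: measurable_dist_powR.
- exact: measurable_dist_powR.
- by move=> t; rewrite mulr_ge0 ?powR_ge0.
- by move=> t; exact: powR_ge0.
- by move=> t; exact: powR_ge0.
- exact: HC.
- exact: HC.
move=> t Yt /not_orP[/= tp tq]; rewrite !mul1r.
have pt0 : 0 < d p t by apply: d_gt0 => e; exact: tp.
have qt0 : 0 < d q t by apply: d_gt0 => e; exact: tq.
have [pq_le|/ltW qp_le] := leP (d p t) (d q t).
  rewrite ler_wpDr ?powR_ge0// opprD -powR_mulN// ler_wpM2l ?powR_ge0//.
  exact: ler_powRN.
rewrite ler_wpDl ?powR_ge0// opprD addrC -powR_mulN// mulrC.
by rewrite ler_wpM2l ?powR_ge0// ler_powRN.
Qed.

(* In the critical case [s1 + s2 = ups], raising [s1] by a small [e] costs only a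
   factor [D `^ e] and makes the pair supercritical. *)
Lemma integral_pair s1 s2 eps : 0 <= s1 < ups -> 0 <= s2 < ups -> 0 < eps ->
  exists2 C, 0 <= C & forall p q, Y p -> Y q -> p <> q ->
  (\int[nu]_(t in Y) (d p t `^ (- s1) * d q t `^ (- s2))%:E <=
     (C * d p q `^ (- a1_exp ups s1 s2 eps))%:E)%E.
Proof.
move=> s1u s2u eps0; have /andP[s10 s1l] := s1u; have /andP[s20 s2l] := s2u.
rewrite /a1_exp; case: ltgtP => s12.
- have [C C0 HC] := integral_pair_lt s10 s20 s12; exists C => // p q Yp Yq pq.
  by rewrite oppr0 powRr0 mulr1 HC.
- exact: integral_pair_gt.
(* The half keeps [s1 + e] below [ups], and [e <= eps] allows the final exponent [e] to be raised to
   [eps]. *)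
pose e := Num.min eps ((ups - s1) / 2).
have e0 : 0 < e by rewrite lt_min eps0/= divr_gt0// subr_gt0.
have e_eps : e <= eps by rewrite ge_min lexx.
have e_s1 : e <= (ups - s1) / 2 by rewrite ge_min lexx orbT.
have [|//||C C0 HC] := @integral_pair_gt (s1 + e) s2.
- by apply/andP; split; lra.
- by lra.
exists (D `^ e * C * D `^ (eps - e)); first by rewrite !mulr_ge0 ?powR_ge0.
move=> p q Yp Yq pq.
apply: le_trans (_ : (_ <= (D `^ e * (C * d p q `^ (- (s1 + e + s2 - ups))) + 0 * 0)%:E)%E) _.
  apply: (@ge0_integral_le_lin2 _ _ _ nu _ [set p] _
    (fun t => d p t `^ (- (s1 + e)) * d q t `^ (- s2)) (cst 0)) => //.
  - exact: measurable_carrier.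
  - exact: measurable_point.
  - exact: measure_point.
  - by move=> t; rewrite mulr_ge0 ?powR_ge0.
  - by move=> t; rewrite mulr_ge0 ?powR_ge0.
  - exact: powR_ge0.
  - exact: HC.
  - by rewrite integral0.
  move=> t Yt /= tp; rewrite mul0r addr0 mulrA ler_wpM2r ?powR_ge0//.
  have pt0 : 0 < d p t by apply: d_gt0 => h; exact: tp.
  have := powRN_exchange pt0 (diam Yp Yt) (_ : s1 <= s1 + e).
  by rewrite addrAC subrr add0r; apply; rewrite lerDl ltW.
rewrite lee_fin mul0r addr0 -!mulrA !ler_wpM2l ?powR_ge0//.
rewrite (_ : s1 + e + s2 - ups = e); last by rewrite -s12; ring.
exact: powRN_exchange (d_gt0 pq) (diam Yp Yq) e_eps.
Qed.

(** * Measurability and mean continuity of kernels *)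

Lemma measurable_continuous_off p (f : M -> R[i]) (phi : R[i] -> R) : Y p ->
  (forall a b, `|phi a - phi b| <= normc (a - b)) ->
  (forall t, Y t -> t <> p -> forall e, 0 < e -> exists2 delta, 0 < delta &
     forall t', Y t' -> t' <> p -> d t t' < delta -> normc (f t' - f t) < e) ->
  measurable_fun Y (fun t => phi (f t)).
Proof.
move=> Yp lip cf; have mp := measurable_point Yp.
have mYp : measurable (Y `\ p) by apply: measurableD => //; exact: measurable_carrier.
(* Nothing is known about [f] at [p], so that point is split off; every function on a singleton is
   measurable. *)
rewrite [X in measurable_fun X](_ : _ = (Y `\ p) `|` [set p]); last first.
  by rewrite setUC setD1K.
apply/measurable_funU => //; split; last by apply: measurable_fun_set1.
apply: lsc_measurable_fun => //.
move=> t a [Yt tp] at_; have e0 : 0 < phi (f t) - a by rewrite subr_gt0.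
have [delta delta0 Hd] := cf t Yt tp _ e0; exists delta => // t' [Yt' t'p] tt'.
have := Hd t' Yt' t'p tt'; have := lip (f t) (f t').
rewrite -(normc_opp (f t - _)) opprB => h1 h2.
by have := le_lt_trans (le_trans (ler_norm _) h1) h2; rewrite ltrD2l ltrN2.
Qed.

Lemma cmeasurable_continuous_off p (f : M -> R[i]) : Y p ->
  (forall t, Y t -> t <> p -> forall e, 0 < e -> exists2 delta, 0 < delta &
     forall t', Y t' -> t' <> p -> d t t' < delta -> normc (f t' - f t) < e) ->
  cmeasurable Y f.
Proof.
move=> Yp cf; split.
  apply: (measurable_continuous_off (phi := @complex.Re R) Yp _ cf) => a b.
  by rewrite (_ : _ - _ = complex.Re (a - b)) ?normc_Re//; case: a b => ? ? [].
apply: (measurable_continuous_off (phi := @complex.Im R) Yp _ cf) => a b.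
by rewrite (_ : _ - _ = complex.Im (a - b)) ?normc_Im//; case: a b => ? ? [].
Qed.

Lemma offdiag_continuous_flip (K : M -> M -> R[i]) :
  offdiag_continuous d Y K -> offdiag_continuous d Y (fun x y => K y x).
Proof.
move=> cK x y Yx Yy xy e e0.
have [|delta delta0 Hd] := cK y x Yy Yx _ e e0; first by move=> h; exact: xy.
by exists delta => // x' y' Yx' Yy' xy' dx dy; apply: Hd => // h; exact: xy'.
Qed.

Lemma cmeasurable_kernel (K : M -> M -> R[i]) x : offdiag_continuous d Y K -> Y x ->
  cmeasurable Y (K x).
Proof.
move=> cK Yx; apply: (cmeasurable_continuous_off Yx) => t Yt tx e e0.
have [|delta delta0 Hd] := cK x t Yx Yt _ e e0; first by move=> h; exact: tx.
exists delta => // t' Yt' t'x tt'; apply: Hd => //; last by rewrite d_xx.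
by move=> h; exact: t'x.
Qed.

Lemma cmeasurable_kernel_mul (K1 K2 : M -> M -> R[i]) x y :
  offdiag_continuous d Y K1 -> offdiag_continuous d Y K2 -> Y x -> Y y ->
  cmeasurable Y (fun t => K1 x t * K2 t y).
Proof.
move=> c1 c2 Yx Yy; apply: cmeasurable_mul; first exact: cmeasurable_kernel.
exact: (cmeasurable_kernel (offdiag_continuous_flip c2)).
Qed.

Lemma carrier_lty : (nu Y < +oo)%E.
Proof.
have [->|/set0P[p Yp]] := eqVneq Y set0; first by rewrite measure0.
rewrite -(carrier_ball Yp); apply: le_lt_trans (ahlfors Yp _) (ltry _).
by rewrite mulr_gt0.
Qed.

(* Dominated convergence along a sequence tending to [x0]: away from [x0] the
   kernel is bounded, and [nu] is finite on [Y]. *)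
Lemma kernel_continuous_away (K : M -> M -> R[i]) s C x0 delta e :
  offdiag_continuous d Y K -> 0 <= s ->
  (forall x t, Y x -> Y t -> x <> t -> normc (K x t) <= C * d x t `^ (- s)) ->
  0 <= C -> Y x0 -> 0 < delta -> 0 < e ->
  exists2 delta', 0 < delta' & forall x, Y x -> d x0 x < delta' ->
    (\int[nu]_(t in Y `\` mball d x0 delta) (normc (K x t - K x0 t))%:E <= e%:E)%E.
Proof.
move=> cK s0 Kle C0 Yx0 delta0 e0; apply: contrapT => noexist.
(* A failing [delta'] at every scale yields a bad sequence. The bound [delta / 2] keeps its points
   at least [delta / 2] away from the domain of integration. *)
have seq n : exists x, [/\ Y x, d x0 x < delta / 2, d x0 x < n.+1%:R^-1 &
    ~ (\int[nu]_(t in Y `\` mball d x0 delta) (normc (K x t - K x0 t))%:E <= e%:E)%E].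
  apply: contrapT => nox; apply: noexist.
  exists (Num.min (delta / 2) n.+1%:R^-1).
    by rewrite lt_min divr_gt0//= invr_gt0.
  move=> x Yx; rewrite lt_min => /andP[x1 x2]; apply: contrapT => h.
  by apply: nox; exists x.
have [x_ Hx] := choice seq.
set Z := Y `\` mball d x0 delta.
have mZ : measurable Z by exact: measurable_setD_mball.
have ZY : Z `<=` Y by move=> ? [].
pose f n t := (normc (K (x_ n) t - K x0 t))%:E.
have far n t : Z t -> delta / 2 <= d (x_ n) t.
  move=> [Yt /negP]; rewrite -leNgt => dt; have [_ h _ _] := Hx n.
  by have := d_tri (x_ n) x0 t; lra.
have far0 t : Z t -> delta / 2 <= d x0 t.
  by move=> [Yt /negP]; rewrite -leNgt => dt; lra.
have d2 : 0 < delta / 2 by lra.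
have ne x t : delta / 2 <= d x t -> x <> t by move=> h xt; move: h; rewrite xt d_xx; lra.
have mf n : measurable_fun Z (f n).
  have [Yx _ _ _] := Hx n.
  have mK := cmeasurable_normc
    (cmeasurable_sub (cmeasurable_kernel cK Yx) (cmeasurable_kernel cK Yx0)).
  by apply/measurable_EFinP; exact: (measurable_funS measurable_carrier ZY mK).
(* The two summands bound the kernel at the moving point and at [x0]. *)
pose B := C * (delta / 2) `^ (- s) + C * (delta / 2) `^ (- s).
have iB : nu.-integrable Z (EFin \o cst B).
  apply: measurable_bounded_integrable => //.
    apply: le_lt_trans carrier_lty; apply: le_measure; rewrite ?inE//.
    exact: measurable_carrier.
  exact: bounded_cst.
have bound x t : Y x -> Y t -> delta / 2 <= d x t ->
    normc (K x t) <= C * (delta / 2) `^ (- s).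
  move=> Yx Yt h; apply: le_trans (Kle x t Yx Yt (ne _ _ h)) _.
  by rewrite ler_wpM2l// ler_powRN.
have [] := @dominated_convergence _ _ _ nu Z mZ f (cst 0%E) (EFin \o cst B) mf.
- exact: measurable_cst.
- apply: aeW => t Zt /=; apply: cvg_EFin; first exact: nearW.
  apply/cvgr0Pnorm_lt => eta eta0.
  have [|del del0 Hdel] := cK x0 t Yx0 (ZY _ Zt) _ eta eta0; first exact/ne/far0.
  near=> n; rewrite /= ger0_norm ?normc_ge0//.
  have [Yx _ h _] := Hx n; apply: Hdel => //.
  + exact: ZY.
  + exact/ne/far.
  + apply: lt_trans h _; rewrite invf_plt ?posrE//.
    apply: (@lt_trans _ _ n%:R); last by rewrite ltr_nat.
    by near: n; exact: nbhs_infty_gtr.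
  by rewrite d_xx.
- exact: iB.
- apply: aeW => t n Zt; have [Yx _ _ _] := Hx n.
  rewrite /f /= lee_fin ger0_norm ?normc_ge0//.
  apply: le_trans (normc_sub_le _ _) _; rewrite lerD// bound//; try exact: ZY.
  + exact: far.
  + exact: far0.
move=> _ _; rewrite integral0 => /fine_cvgP[fin /cvgrPdist_lt /(_ e e0) small].
(* The integrals tend to 0, so some term lies below [e], against the choice of [x_]. *)
have [n _ /(_ n (leqnn n)) []] : \forall n \near \oo,
    (\int[nu]_(t in Z) f n t \is a fin_num)%E /\
    `|0 - fine (\int[nu]_(t in Z) f n t)%E| < e by near=> n; split; near: n.
move=> fn; rewrite sub0r normrN => lt.
have [_ _ _] := Hx n; apply; rewrite -/Z -(fineK fn) lee_fin.
exact: le_trans (ler_norm _) (ltW lt).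
Unshelve. all: end_near. Qed.

(** * Size, continuity and Hoelder bounds of the composed kernel *)

Section product_kernel.
Variables (s1 t1 C1 C2 : R) (K1 K2 : M -> M -> R[i]).
Hypothesis s1_range : 0 <= s1 < ups.
Hypothesis t1_range : 0 <= t1 < ups.
Hypothesis K1_cont : offdiag_continuous d Y K1.
Hypothesis K2_cont : offdiag_continuous d Y K2.
Hypothesis C1_ge0 : 0 <= C1.
Hypothesis C2_ge0 : 0 <= C2.
Hypothesis K1_le : forall x y, Y x -> Y y -> x <> y ->
  normc (K1 x y) <= C1 * d x y `^ (- s1).
Hypothesis K2_le : forall x y, Y x -> Y y -> x <> y ->
  normc (K2 x y) <= C2 * d x y `^ (- t1).

Let F x y t := K1 x t * K2 t y.
Let K3 x y := cintegral nu Y (F x y).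

Let measurable_F x y : Y x -> Y y -> cmeasurable Y (F x y).
Proof. exact: cmeasurable_kernel_mul. Qed.

Let measurable_FB x y x' y' : Y x -> Y y -> Y x' -> Y y' ->
  measurable_fun Y (fun t => normc (F x y t - F x' y' t)).
Proof.
by move=> *; apply: cmeasurable_normc; apply: cmeasurable_sub; exact: measurable_F.
Qed.

Let F_le x y t : Y x -> Y y -> Y t -> t <> x -> t <> y ->
  normc (F x y t) <= C1 * C2 * (d x t `^ (- s1) * d y t `^ (- t1)).
Proof.
move=> Yx Yy Yt tx ty; rewrite normc_mul mulrACA ler_pM ?normc_ge0//.
  by apply: K1_le => // h; exact: tx.
by rewrite (d_sym y); exact: K2_le.
Qed.

(** Collects the poles where pointwise bounds fail; when fewer than three occur, a point is
    repeated. *)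
Let null_points x y z : Y x -> Y y -> Y z ->
  measurable ([set x] `|` [set y] `|` [set z]) /\
  nu ([set x] `|` [set y] `|` [set z]) = 0%E.
Proof.
move=> Yx Yy Yz; have [mx my mz] :
  [/\ measurable [set x], measurable [set y] & measurable [set z]].
  by split; exact: measurable_point.
have mxy := measurableU _ _ mx my; split; first exact: measurableU.
by rewrite !measureU0 ?measure_point.
Qed.

Lemma integral_product_le eps : 0 < eps -> exists2 C, 0 <= C &
  forall x y, Y x -> Y y -> x <> y ->
  (\int[nu]_(t in Y) (normc (F x y t))%:E <=
     (C * d x y `^ (- a1_exp ups s1 t1 eps))%:E)%E.
Proof.
move=> eps0; have [C C0 HC] := integral_pair s1_range t1_range eps0.
exists (C1 * C2 * C); first by rewrite !mulr_ge0.
move=> x y Yx Yy xy; have [mN N0] := null_points Yx Yy Yy.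
rewrite (_ : _ * _ `^ _ = C1 * C2 * (C * d x y `^ (- a1_exp ups s1 t1 eps)) + 0 * 0);
  last by rewrite mul0r addr0 mulrA.
apply: (@ge0_integral_le_lin2 _ _ _ nu Y _ _
  (fun t => d x t `^ (- s1) * d y t `^ (- t1)) (cst 0) _ _ _ _ _ mN N0) => //.
- exact: measurable_carrier.
- exact/cmeasurable_normc/measurable_F.
- by move=> t; exact: normc_ge0.
- by move=> t; rewrite mulr_ge0 ?powR_ge0.
- by rewrite mulr_ge0.
- exact: HC.
- by rewrite integral0.
move=> t Yt /not_orP[/not_orP[/= tx ty] _]; rewrite mul0r addr0.
exact: F_le.
Qed.

Lemma cintegrable_product x y : Y x -> Y y -> x <> y -> cintegrable nu Y (F x y).
Proof.
move=> Yx Yy xy; have [C _ HC] := integral_product_le ltr01.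
exact: cintegrable_le measurable_carrier _ _ (measurable_F Yx Yy) (HC x y Yx Yy xy).
Qed.

Lemma cintegral_product_le eps : 0 < eps -> exists C,
  forall x y, Y x -> Y y -> x <> y ->
  d x y `^ (a1_exp ups s1 t1 eps) * normc (K3 x y) <= C.
Proof.
move=> eps0; have [C C0 HC] := integral_product_le eps0; exists (2 * C).
move=> x y Yx Yy xy.
have := normc_cintegral_le measurable_carrier (measurable_F Yx Yy) (HC x y Yx Yy xy).
move=> /(ler_wpM2l (powR_ge0 (d x y) (a1_exp ups s1 t1 eps))) /le_trans; apply.
rewrite [leLHS](_ : _ = 2 * C * (d x y `^ a1_exp ups s1 t1 eps *
  d x y `^ (- a1_exp ups s1 t1 eps))); last by ring.
by rewrite powR_mulN ?d_gt0// subrr powRr0 mulr1.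
Qed.

Lemma normc_cintegral_productB_le x y x' y' C :
  Y x -> Y y -> x <> y -> Y x' -> Y y' -> x' <> y' ->
  (\int[nu]_(t in Y) (normc (F x y t - F x' y' t))%:E <= C%:E)%E ->
  normc (K3 x y - K3 x' y') <= 2 * C.
Proof.
move=> Yx Yy xy Yx' Yy' xy' h.
rewrite /K3 -(cintegralB measurable_carrier); try exact: cintegrable_product.
apply: (normc_cintegral_le measurable_carrier) h.
by apply: cmeasurable_sub; exact: measurable_F.
Qed.

(** No cancellation is used: each product is bounded by its own pair of weights, with a common
    separation [rho]. The centre [z] is free because continuity needs balls around both poles, and
    the Hoelder bound one around [x']. *)
Lemma integral_ball_productB : exists2 C, 0 <= C &
  forall z x y x' y' rho r, Y z -> Y x -> Y y -> Y x' -> Y y' ->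
    0 < rho -> rho <= d x y -> rho <= d x' y' -> 0 < r ->
  (\int[nu]_(t in mball d z r `&` Y) (normc (F x y t - F x' y' t))%:E <=
   (C * (rho `^ (- t1) * r `^ (ups - s1) + rho `^ (- s1) * r `^ (ups - t1)))%:E)%E.
Proof.
have [C C0 HC] := integral_ball_pair s1_range t1_range.
exists (C1 * C2 * C + C1 * C2 * C); first by rewrite addr_ge0 ?mulr_ge0.
move=> z x y x' y' rho r Yz Yx Yy Yx' Yy' rho0 rho_le rho_le' r0.
have [mN N0] := null_points Yx Yy Yx'.
have [mN' N0'] := null_points Yy' Yy' Yy'.
have mNN := measurableU _ _ mN mN'.
have NN0 : nu (([set x] `|` [set y] `|` [set x']) `|`
    ([set y'] `|` [set y'] `|` [set y'])) = 0%E by rewrite measureU0.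
have mB := measurable_mball z r.
have BY : mball d z r `&` Y `<=` Y by exact: subIsetr.
rewrite mulrDl -!(mulrA (C1 * C2)).
apply: (@ge0_integral_le_lin2 _ _ _ nu _ _ _
  (fun t => d x t `^ (- s1) * d y t `^ (- t1))
  (fun t => d x' t `^ (- s1) * d y' t `^ (- t1)) _ _ _ _ mB mNN NN0).
- exact: (measurable_funS measurable_carrier BY (measurable_FB Yx Yy Yx' Yy')).
- exact: (measurable_funS measurable_carrier BY (measurable_pair _ _ _ _)).
- exact: (measurable_funS measurable_carrier BY (measurable_pair _ _ _ _)).
- by move=> t; exact: normc_ge0.
- by move=> t; rewrite mulr_ge0 ?powR_ge0.
- by move=> t; rewrite mulr_ge0 ?powR_ge0.
- by rewrite mulr_ge0.
- by rewrite mulr_ge0.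
- exact: HC.
- exact: HC.
move=> t [_ Yt] /not_orP[/not_orP[/not_orP[/= tx ty] tx'] /not_orP[_ ty']].
by apply: le_trans (normc_sub_le _ _) _; rewrite lerD//; exact: F_le.
Qed.

(** Small balls around [x0] and [y0] contribute little uniformly in nearby [x], [y]; on the
    remaining set both kernels are bounded and converge in mean. *)
Lemma cintegral_product_continuous : offdiag_continuous d Y K3.
Proof.
move=> x0 y0 Yx0 Yy0 xy0 e e0; have rho0 := d_gt0 xy0.
have [C C0 HC] := integral_ball_productB.
have /andP[s10 s1u] := s1_range; have /andP[t10 t1u] := t1_range.
set rho := d x0 y0 in rho0 *.
(* [rho / 2] will bound from below the separation of both pairs of poles. *)
pose Q r := C * ((rho / 2) `^ (- t1) * r `^ (ups - s1) +
                 (rho / 2) `^ (- s1) * r `^ (ups - t1)).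
(* Three pieces of size [e / 10], doubled by the passage to the complex integral, stay below [e]. *)
have [delta delta0 Qsmall] : exists2 r, 0 < r & Q r <= e / 10.
  pose A := (rho / 2) `^ (- t1); pose B := (rho / 2) `^ (- s1).
  have A0 : 0 <= A by exact: powR_ge0.
  have B0 : 0 <= B by exact: powR_ge0.
  (* The added 1 keeps the denominator positive when [C * (A + B)] vanishes; [eta] below is built
     the same way. *)
  pose w := e / 10 / (C * (A + B) + 1).
  have w0 : 0 < w by rewrite !divr_gt0// ltr_wpDl// mulr_ge0// addr_ge0.
  have [r r0 [h1 h2]] : exists2 r, 0 < r & r `^ (ups - s1) <= w /\ r `^ (ups - t1) <= w.
    have small a : 0 < a -> exists2 r, 0 < r & forall r', 0 < r' -> r' <= r -> r' `^ a <= w.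
      move=> a0; exists (w `^ a^-1); first exact: powR_gt0.
      move=> r' r'0 h; have -> : w = (w `^ a^-1) `^ a.
        by rewrite -powRrM mulVf ?gt_eqF// powRr1// ltW.
      by rewrite ge0_ler_powR ?nnegrE ?powR_ge0// ltW.
    have [|r1 r10 H1] := small (ups - s1); first by rewrite subr_gt0.
    have [|r2 r20 H2] := small (ups - t1); first by rewrite subr_gt0.
    exists (Num.min r1 r2); first by rewrite lt_min r10.
    by split; [apply: H1|apply: H2]; rewrite ?lt_min ?r10// ge_min lexx ?orbT.
  exists r => //; rewrite /Q -/A -/B.
  apply: (@le_trans _ _ (C * (A + B) * w)).
    by rewrite -mulrA ler_wpM2l// mulrDl lerD// ler_wpM2l.
  rewrite /w mulrA ler_pdivrMr; last by rewrite ltr_wpDl// mulr_ge0// addr_ge0.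
  by rewrite mulrC ler_wpM2l ?lerDl// divr_ge0// ltW.
(* [k1] bounds [K1 x0 t], whose pole is fixed; [k2] bounds [K2 t y], whose pole moves, so that only
   the distance [delta / 2] is left. *)
pose k1 := C1 * delta `^ (- s1); pose k2 := C2 * (delta / 2) `^ (- t1).
have k10 : 0 <= k1 by rewrite mulr_ge0 ?powR_ge0.
have k20 : 0 <= k2 by rewrite mulr_ge0 ?powR_ge0.
pose eta := e / 10 / (k1 + k2 + 1).
have eta0 : 0 < eta by rewrite !divr_gt0//; lra.
have K2_le' x y : Y x -> Y y -> x <> y -> normc (K2 y x) <= C2 * d x y `^ (- t1).
  by move=> Yx Yy xy; rewrite d_sym; apply: K2_le => // h; exact: xy.
have [del1 del10 H1] :=
  kernel_continuous_away K1_cont s10 K1_le C1_ge0 Yx0 delta0 eta0.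
have [del2 del20 H2] := kernel_continuous_away (offdiag_continuous_flip K2_cont)
  t10 K2_le' C2_ge0 Yy0 delta0 eta0.
(* [del1] and [del2] control the kernel differences, [rho / 4] keeps [d x y] above [rho / 2], and
   [delta / 2] keeps [y] away from [Z]. *)
pose del := Num.min (Num.min del1 del2) (Num.min (rho / 4) (delta / 2)).
exists del; first by rewrite !lt_min del10 del20 !divr_gt0.
move=> x y Yx Yy xy; rewrite !lt_min.
move=> /andP[/andP[x1 _] /andP[x3 x4]] /andP[/andP[_ y2] /andP[y3 y4]].
have rho_le : rho / 2 <= d x y.
  have := d_tri x x0 y0; have := d_tri y x y0; rewrite (d_sym y y0) -/rho; lra.
have rho_le0 : rho / 2 <= d x0 y0 by rewrite -/rho; lra.
have rho20 : 0 < rho / 2 by lra.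
pose f t := normc (F x y t - F x0 y0 t).
have mf : measurable_fun Y f by exact: measurable_FB.
have f0 t : 0 <= f t by exact: normc_ge0.
have mY := measurable_carrier.
have mBx := measurable_mball x0 delta; have mBy := measurable_mball y0 delta.
pose Z := (Y `\` mball d x0 delta) `&` (Y `\` mball d y0 delta).
have mZ : measurable Z by apply: measurableI; exact: measurable_setD_mball.
have ZY : Z `<=` Y by move=> t [[]].
have intBx : (\int[nu]_(t in mball d x0 delta `&` Y) (f t)%:E <= (e / 10)%:E)%E.
  by apply: le_trans (HC _ _ _ _ _ (rho / 2) _ _ _ _ _ _ _ _ _ _) _.
have intBy : (\int[nu]_(t in mball d y0 delta `&` Y) (f t)%:E <= (e / 10)%:E)%E.
  by apply: le_trans (HC _ _ _ _ _ (rho / 2) _ _ _ _ _ _ _ _ _ _) _.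
pose g1 t := normc (K1 x t - K1 x0 t); pose g2 t := normc (K2 t y - K2 t y0).
have mg1 : measurable_fun Y g1.
  by apply: cmeasurable_normc; apply: cmeasurable_sub; exact: cmeasurable_kernel.
have mg2 : measurable_fun Y g2.
  apply: cmeasurable_normc; apply: cmeasurable_sub.
    exact: (cmeasurable_kernel (offdiag_continuous_flip K2_cont) Yy).
  exact: (cmeasurable_kernel (offdiag_continuous_flip K2_cont) Yy0).
have mono (h : M -> R) p : measurable_fun Y h -> (forall t, 0 <= h t) ->
    Z `<=` Y `\` mball d p delta ->
    (\int[nu]_(t in Y `\` mball d p delta) (h t)%:E <= eta%:E)%E ->
    (\int[nu]_(t in Z) (h t)%:E <= eta%:E)%E.
  move=> mh h0 Zp; apply: le_trans; apply: ge0_subset_integral => //.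
  - exact: measurable_setD_mball.
  - apply/measurable_EFinP.
    by apply: (measurable_funS mY _ mh) => t [].
  by move=> t _; rewrite lee_fin.
have intZ : (\int[nu]_(t in Z) (f t)%:E <= (e / 10)%:E)%E.
  apply: le_trans (_ : (_ <= (k2 * eta + k1 * eta)%:E)%E) _; last first.
    rewrite lee_fin -mulrDl /eta mulrA ler_pdivrMr; last by lra.
    by rewrite mulrC ler_wpM2l//; lra.
  apply: (@ge0_integral_le_lin2 _ _ _ nu Z set0 f g1 g2) => //.
  - exact: (measurable_funS mY ZY mf).
  - exact: (measurable_funS mY ZY mg1).
  - exact: (measurable_funS mY ZY mg2).
  - by move=> t; exact: normc_ge0.
  - by move=> t; exact: normc_ge0.
  - apply: mono (mg1) _ _ (H1 x Yx x1); first by move=> t; exact: normc_ge0.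
    by move=> t [].
  - apply: mono (mg2) _ _ (H2 y Yy y2); first by move=> t; exact: normc_ge0.
    by move=> t [].
  move=> t [[Yt /negP]]; rewrite -leNgt => xt [_ /negP]; rewrite -leNgt => yt _.
  have yt' : delta / 2 <= d y t by have := d_tri y y0 t; lra.
  (* Telescoping moves one kernel at a time, so that each difference is multiplied by a bounded
     factor. *)
  rewrite /f (_ : _ - _ = K2 t y * (K1 x t - K1 x0 t) + K1 x0 t * (K2 t y - K2 t y0)).
    apply: le_trans (normc_add_le _ _) _; rewrite !normc_mul lerD//.
      rewrite ler_wpM2r ?normc_ge0//; apply: le_trans (K2_le' y t Yy Yt _) _.
        by move=> h; move: yt'; rewrite h d_xx; lra.
      by rewrite ler_wpM2l// ler_powRN//; lra.
    rewrite ler_wpM2r ?normc_ge0//; apply: le_trans (K1_le Yx0 Yt _) _.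
      by move=> h; move: xt; rewrite h d_xx; lra.
    by rewrite ler_wpM2l// ler_powRN.
  by rewrite /F; ring.
have intY : (\int[nu]_(t in Y) (f t)%:E <= (e / 10 + (e / 10 + e / 10))%:E)%E.
  have YU : Y `<=` (mball d x0 delta `&` Y) `|` ((mball d y0 delta `&` Y) `|` Z).
    move=> t Yt; have [xt|xt] := pselect (mball d x0 delta t); first by left.
    by right; have [yt|yt] := pselect (mball d y0 delta t); [left|right].
  have mBZ := measurableU _ _ mBy mZ.
  apply: le_trans (ge0_integral_le_setU nu mY mBx mBZ YU _ f0) _.
    by apply: (measurable_funS mY _ mf) => t [[]|[[]|[[]]]].
  rewrite EFinD leeD//.
  apply: le_trans (ge0_integral_le_setU nu mBZ mBy mZ (fun _ => id) _ f0) _.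
    by apply: (measurable_funS mY _ mf) => t [[]|[[]]].
  by rewrite EFinD leeD.
apply: le_lt_trans (normc_cintegral_productB_le Yx Yy xy Yx0 Yy0 xy0 intY) _; lra.
Qed.

(** Both terms of the ball estimate are brought to the single form with exponents [m] and [- a]:
    distances are bounded by the diameter, so powers may be exchanged at the cost of constants. *)
Lemma integral_ball_productB_le m a : m <= ups - s1 -> m <= ups - t1 ->
  s1 <= a -> t1 <= a -> exists2 C, 0 <= C &
  forall x' x'' y, Y x' -> Y x'' -> Y y -> x' <> x'' -> 2 * d x' x'' <= d x' y ->
  (\int[nu]_(t in mball d x' (2 * d x' x'') `&` Y)
     (normc (F x' y t - F x'' y t))%:E <=
   (C * (d x' x'' `^ m * d x' y `^ (- a)))%:E)%E.
Proof.
move=> m1 m2 a1 a2; have [C C0 HC] := integral_ball_productB.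
pose k1 := D `^ (a - t1) * (2 * D) `^ (- m - (s1 - ups)).
pose k2 := D `^ (a - s1) * (2 * D) `^ (- m - (t1 - ups)).
pose k3 := (2^-1 : R) `^ (- a) * 2 `^ m.
exists (C * ((k1 + k2) * k3)).
  by rewrite !(mulr_ge0, addr_ge0, powR_ge0).
move=> x' x'' y Yx' Yx'' Yy xx far; have r0 := d_gt0 xx.
set r := d x' x'' in r0 far *; set rho := d x' y in far *.
have rho0 : 0 < rho by lra.
(* Since [r] is at most [rho / 2], moving from [x'] to [x''] loses at most half of the separation
   from [y]. *)
have rho2 : rho / 2 <= d x'' y.
  by have := d_tri x'' x' y; rewrite -/r -/rho; lra.
have rho2' : rho / 2 <= d x' y by rewrite -/rho; lra.
apply: le_trans (HC x' x' y x'' y (rho / 2) (2 * r) _ _ _ _ _ _ _ _ _) _ => //.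
- by lra.
- by lra.
have rhoD : rho / 2 <= D by have := diam Yx' Yy; rewrite -/rho; lra.
have rD : 2 * r <= 2 * D by have := diam Yx' Yx''; rewrite -/r; lra.
have r20 : 0 < 2 * r by lra.
have rho20 : 0 < rho / 2 by lra.
rewrite lee_fin -mulrA ler_wpM2l//.
have e3 : (k1 + k2) * k3 * (r `^ m * rho `^ (- a)) =
    k1 * ((rho / 2) `^ (- a) * (2 * r) `^ m) + k2 * ((rho / 2) `^ (- a) * (2 * r) `^ m).
  rewrite (powRM _ (ltW rho0))// (powRM _ _ (ltW r0))// /k3; ring.
have pr z : ups - z = - (z - ups) by rewrite opprB.
have key z z' : m <= ups - z -> z' <= a ->
  (rho / 2) `^ (- z') * (2 * r) `^ (ups - z) <=
  D `^ (a - z') * (2 * D) `^ (- m - (z - ups)) * ((rho / 2) `^ (- a) * (2 * r) `^ m).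
  move=> mz za; rewrite mulrACA; apply: ler_pM; rewrite ?powR_ge0//.
    exact: powRN_exchange.
  (* The positive power of the radius is written with a doubly negated exponent so that
     [powRN_exchange] lowers it to [m]. *)
  rewrite pr -{2}(opprK m); apply: powRN_exchange => //.
  by rewrite -(opprB ups) lerN2.
by rewrite e3 lerD// key.
Qed.

Lemma cintegral_product_holder s2' s2'' s3 C3 eps : 0 <= s2' < ups ->
  0 <= s2'' <= s3 -> 0 < eps -> 0 <= C3 ->
  (forall x' x'' y, Y x' -> Y x'' -> x' <> x'' -> Y y -> ~ mball d x' (2 * d x' x'') y ->
     normc (K1 x' y - K1 x'' y) <=
     C3 * (d x' x'' `^ s3 * d x' y `^ (- (s2' + s2'')))) ->
  let m := Num.min (s3 - s2'') (Num.min (ups - s1) (ups - t1)) in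
  let a := a2_exp ups s1 t1 s2' eps in
  exists C, forall x' x'' y, Y x' -> Y x'' -> x' <> x'' -> Y y ->
    ~ mball d x' (2 * d x' x'') y ->
    d x' y `^ a / d x' x'' `^ m * normc (K3 x' y - K3 x'' y) <= C.
Proof.
move=> s2'u /andP[s2''0 s2''3] eps0 C30 HK1 m a.
have m1 : m <= ups - s1 by rewrite /m !ge_min lexx !orbT.
have m2 : m <= ups - t1 by rewrite /m !ge_min lexx !orbT.
have m3 : m <= s3 - s2'' by rewrite /m ge_min lexx.
have /andP[s10 _] := s1_range; have /andP[t10 _] := t1_range.
(* The maximum in [a2_exp] collects the exponents [s1], [t1] of the near part and that of the pair
   [s2'], [t1] of the far part; in the subcritical case the latter is 0, below [s1]. *)
have [a1 a2 a3] : [/\ s1 <= a, t1 <= a & a1_exp ups s2' t1 eps <= a].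
  have h1 : s1 <= Num.max s1 t1 by rewrite le_max lexx.
  have h2 : t1 <= Num.max s1 t1 by rewrite le_max lexx orbT.
  have h0 := le_trans s10 h1.
  rewrite /a /a2_exp /a1_exp; move: (Num.max s1 t1) h0 h1 h2 => S h0 h1 h2.
  by case: ltgtP => _; split => //; rewrite le_max ?h1 ?h2 ?orbT// lexx.
have [Cn Cn0 near] := integral_ball_productB_le m1 m2 a1 a2.
have [Cp Cp0 pair] := integral_pair s2'u t1_range eps0.
(* The powers of [D] pay for replacing [s3 - s2''] by [m] and the far exponent by [a]. *)
pose k := C3 * C2 * Cp * D `^ (s3 - s2'' - m) * D `^ (a - a1_exp ups s2' t1 eps).
exists (2 * (Cn + k)) => x' x'' y Yx' Yx'' xx Yy ynear.
have r0 := d_gt0 xx; have far : 2 * d x' x'' <= d x' y by rewrite leNgt; apply/negP.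
set r := d x' x'' in r0 far ynear *; set rho := d x' y in far *.
have rho0 : 0 < rho by lra.
have xy' : x' <> y by move=> h; move: rho0; rewrite /rho h d_xx ltxx.
(* If [x''] were [y], then [rho] would equal [r], against [2 * r <= rho]. *)
have xy'' : x'' <> y by move=> h; move: far; rewrite /rho -h -/r; lra.
suff bound : (\int[nu]_(t in Y) (normc (F x' y t - F x'' y t))%:E <=
    ((Cn + k) * (r `^ m * rho `^ (- a)))%:E)%E.
  have := normc_cintegral_productB_le Yx' Yy xy' Yx'' Yy xy'' bound.
  have q0 : 0 <= rho `^ a / r `^ m by rewrite divr_ge0 ?powR_ge0.
  move=> /(ler_wpM2l q0) /le_trans; apply.
  rewrite [leLHS](_ : _ = 2 * (Cn + k) * ((rho `^ a * rho `^ (- a)) *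
    (r `^ m * (r `^ m)^-1))); last by ring.
  by rewrite powR_mulN// subrr powRr0 mul1r divff ?mulr1// gt_eqF ?powR_gt0.
have mY := measurable_carrier.
have mB := measurable_mball x' (2 * r); have mC := measurable_setD_mball x' (2 * r).
have CY : Y `\` mball d x' (2 * r) `<=` Y by move=> t [].
have mf := measurable_FB Yx' Yy Yx'' Yy.
have f0 t : 0 <= normc (F x' y t - F x'' y t) by exact: normc_ge0.
have YU : Y = (mball d x' (2 * r) `&` Y) `|` (Y `\` mball d x' (2 * r)).
  by rewrite setIC setUIDK.
apply: le_trans (ge0_integral_le_setU nu mY mB mC _ _ f0) _.
- by rewrite -YU.
- by rewrite -YU.
rewrite (mulrDl Cn) EFinD leeD//; first exact: near.
have [mN N0] := null_points Yx' Yx'' Yy.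
apply: le_trans (_ : (_ <= (C3 * C2 * r `^ (s3 - s2'') *
  (Cp * rho `^ (- a1_exp ups s2' t1 eps)) + 0 * 0)%:E)%E) _.
  apply: (@ge0_integral_le_lin2 _ _ _ nu _ _ _
    (fun t => d x' t `^ (- s2') * d y t `^ (- t1)) (cst 0) _ _ _ _ mC mN N0) => //.
  - exact: (measurable_funS mY CY mf).
  - exact: (measurable_funS mY CY (measurable_pair _ _ _ _)).
  - by move=> t; rewrite mulr_ge0 ?powR_ge0.
  - by rewrite !mulr_ge0 ?powR_ge0.
  - apply: le_trans (pair x' y Yx' Yy xy').
    apply: ge0_subset_integral => //; first exact/measurable_EFinP/measurable_pair.
    by move=> t _; rewrite lee_fin mulr_ge0 ?powR_ge0.
  - by rewrite integral0.
  move=> t [Yt tnear] /not_orP[/not_orP[/= tx' tx''] ty]; rewrite mul0r addr0.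
  have rt : 2 * r <= d x' t by rewrite leNgt; apply/negP.
  rewrite /F -mulrBl normc_mul.
  have h2 : normc (K2 t y) <= C2 * d y t `^ (- t1) by rewrite (d_sym y); exact: K2_le.
  (* Outside the ball [d x' t] is at least [r], so the share [s2''] of the singularity is paid by
     [r], leaving at [x'] the exponent [s2'], which is below [ups]. *)
  have h1 : normc (K1 x' t - K1 x'' t) <= C3 * (r `^ (s3 - s2'') * d x' t `^ (- s2')).
    apply: le_trans (HK1 x' x'' t Yx' Yx'' xx Yt tnear) _; rewrite -/r ler_wpM2l//.
    have dt0 : 0 < d x' t by lra.
    rewrite opprD -!powR_mulN// (mulrC (d x' t `^ _)) mulrA ler_wpM2r ?powR_ge0//.
    by rewrite ler_wpM2l ?powR_ge0// ler_powRN//; lra.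
  apply: le_trans (ler_pM (normc_ge0 _) (normc_ge0 _) h1 h2) _.
  by rewrite le_eqVlt; apply/orP; left; apply/eqP; ring.
rewrite lee_fin mul0r addr0 /k.
have e1 : r `^ (s3 - s2'') <= D `^ (s3 - s2'' - m) * r `^ m.
  rewrite -{1}(opprK (s3 - s2'')) -{2}(opprK m).
  rewrite (_ : s3 - s2'' - m = - m - (- (s3 - s2''))); last by ring.
  by apply: powRN_exchange => //; [exact: diam|rewrite lerN2].
have e2 := powRN_exchange rho0 (diam Yx' Yy) a3.
rewrite [leLHS](_ : _ = C3 * C2 * Cp * (r `^ (s3 - s2'') *
  rho `^ (- a1_exp ups s2' t1 eps))); last by ring.
rewrite [leRHS](_ : _ = C3 * C2 * Cp * ((D `^ (s3 - s2'' - m) * r `^ m) *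
  (D `^ (a - a1_exp ups s2' t1 eps) * rho `^ (- a)))); last by ring.
by rewrite ler_wpM2l ?mulr_ge0// ler_pM ?powR_ge0.
Qed.

End product_kernel.
End ahlfors.
End metric_measure.

(** The local bound covers radii up to some [rho] below the threshold. For larger radii the finite
    measure of [Y] is at most a constant times the power of the radius, which exceeds that of
    [rho]. *)
Lemma upper_Ahlfors_global {dd : measure_display} {M : measurableType dd}
    {R : realType} (d : M -> M -> R) (Y : set M) (nu : {measure set M -> \bar R})
    (ups D : R) :
  (forall U : set M, d_open d U -> measurable (U `&` Y)) -> is_metric d ->
  (forall x r, Y x -> 0 < r -> (nu (mball d x r `&` Y) < +oo)%E) ->
  0 < D -> (forall x y, Y x -> Y y -> d x y <= D) -> 0 < ups ->
  upper_Ahlfors d nu Y ups ->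
  exists2 c, 0 < c & forall x r, Y x -> 0 < r ->
    (nu (mball d x r `&` Y) <= (c * r `^ ups)%:E)%E.
Proof.
move=> borel dm fin D0 diam ups0 [r0 [c0 [r00 c00 H]]].
have mY := measurable_carrier borel; have mB := measurable_mball dm borel.
(* The threshold [r0] may be infinite, whence the case split; it is halved when finite because the
   local bound needs a strict inequality. *)
have [rho rho0 rho_lt] : exists2 rho : R, 0 < rho & (rho%:E < r0)%E.
  case: r0 r00 {H} => [r||] //.
    rewrite lte_fin => r00; exists (r / 2); first by rewrite divr_gt0.
    by rewrite lte_fin ltr_pdivrMr// mulr_natr mulr2n ltrDl.
  by move=> _; exists 1; rewrite ?ltry.
have nuY : (nu Y < +oo)%E.
  have [->|/set0P[p Yp]] := eqVneq Y set0; first by rewrite measure0.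
  have -> : Y = mball d p (2 * D) `&` Y; last by apply: fin; rewrite ?mulr_gt0.
  apply/esym/setIidPr => t Yt; rewrite /mball/=.
  by apply: le_lt_trans (diam _ _ Yp Yt) _; rewrite ltr_pMl// ltr1n.
have nuYE : nu Y = (fine (nu Y))%:E by rewrite fineK// ge0_fin_numE.
have n0 : 0 <= fine (nu Y) by rewrite fine_ge0.
pose c1 := fine (nu Y) / rho `^ ups.
have c10 : 0 <= c1 by rewrite divr_ge0 ?powR_ge0.
exists (c0 + c1) => [|x r Yx r_gt0]; first by rewrite ltr_pwDl.
rewrite mulrDl; have [r_le|/ltW r_ge] := leP r rho.
  apply: le_trans (H x r Yx r_gt0 _) _; last by rewrite lee_fin lerDl mulr_ge0 ?powR_ge0.
  by apply: le_lt_trans rho_lt; rewrite lee_fin.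
apply: (@le_trans _ _ (nu Y)).
  by apply: le_measure; rewrite ?inE//; exact: subIsetr.
rewrite nuYE lee_fin; apply: ler_wpDl; first by rewrite mulr_ge0 ?powR_ge0// ltW.
rewrite /c1 mulrAC ler_pdivlMr ?powR_gt0// ler_wpM2l//.
by rewrite ge0_ler_powR ?nnegrE// ltW.
Qed.

(** Integrability is a separate conclusion because [cintegral] has a value for every function; it
    makes the composed kernel a genuine integral. *)
Theorem theorem4p6 (R : realType) (dd : measure_display) (M : measurableType dd)
  (d : M -> M -> R) (Y : set M) (nu : {measure set M -> \bar R})
  (upsY s1 t1 s3 s2' s2'' : R) (K1 K2 : M -> M -> R[i]) :
  is_metric d ->
  d_bounded d Y ->
  (* the sigma-algebra N = {A `<=` Y measurable} contains all Borel subsets of Y *)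
  (forall U : set M, d_open d U -> measurable (U `&` Y)) ->
  (forall x r, Y x -> 0 < r -> (nu (mball d x r `&` Y) < +oo)%E) ->
  0 < upsY ->
  upper_Ahlfors d nu Y upsY ->
  0 <= s1 < upsY -> 0 <= t1 < upsY -> 0 <= s3 ->
  0 <= s2' < upsY -> 0 <= s2'' <= s3 ->
  (s1 + t1 = upsY \/ s2' + t1 = upsY -> strongly_upper_Ahlfors d nu Y upsY) ->
  Kclass3 d Y s1 (s2' + s2'') s3 K1 ->
  Kclass d Y t1 K2 ->
  (forall x y, Y x -> Y y -> x <> y ->
     cintegrable nu Y (fun t => K1 x t * K2 t y)) /\
  (forall eps : R, 0 < eps ->
     Kclass3 d Y (a1_exp upsY s1 t1 eps) (a2_exp upsY s1 t1 s2' eps)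
       (Num.min (s3 - s2'') (Num.min (upsY - s1) (upsY - t1)))
       (fun x y => cintegral nu Y (fun t => K1 x t * K2 t y))).
Proof.
move=> dm [B HB] borel fin ups0 ahl s1r t1r _ s2'r s2''r _
  [c1 [C1 HC1] [C3 HC3]] [c2 [C2 HC2]].
have [dge0 dxx dsym _] := dm.
have dgt0 x y : x <> y -> 0 < d x y.
  move=> xy; rewrite lt_neqAle dge0 andbT eq_sym; apply/eqP => h; apply: xy.
  exact/dxx.
(* The given bound [B] need not be positive, for instance when [Y] is empty or a point. *)
pose D := Num.max 1 B.
have D0 : 0 < D by rewrite lt_max ltr01.
have diam x y : Y x -> Y y -> d x y <= D.
  by move=> Yx Yy; rewrite le_max HB ?orbT.
have [c c0 ahlfors] := upper_Ahlfors_global borel dm fin D0 diam ups0 ahl.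
(* When [Y] has no two distinct points the class bounds are vacuous and their constants may be
   negative. *)
pose C1' := Num.max 0 C1; pose C2' := Num.max 0 C2; pose C3' := Num.max 0 C3.
have C10 : 0 <= C1' by rewrite le_max lexx.
have C20 : 0 <= C2' by rewrite le_max lexx.
have C30 : 0 <= C3' by rewrite le_max lexx.
have K1_le x y : Y x -> Y y -> x <> y -> normc (K1 x y) <= C1' * d x y `^ (- s1).
  move=> Yx Yy xy; apply: powR_mul_le; first exact: dgt0.
  by apply: le_trans (HC1 x y Yx Yy xy) _; rewrite le_max lexx orbT.
have K2_le x y : Y x -> Y y -> x <> y -> normc (K2 x y) <= C2' * d x y `^ (- t1).
  move=> Yx Yy xy; apply: powR_mul_le; first exact: dgt0.
  by rewrite mulrC; apply: le_trans (HC2 x y Yx Yy xy) _; rewrite le_max lexx orbT.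
have K1_holder x' x'' y : Y x' -> Y x'' -> x' <> x'' -> Y y ->
    ~ mball d x' (2 * d x' x'') y -> normc (K1 x' y - K1 x'' y) <=
    C3' * (d x' x'' `^ s3 * d x' y `^ (- (s2' + s2''))).
  move=> Yx' Yx'' xx Yy far.
  have r0 := dgt0 _ _ xx.
  have rho0 : 0 < d x' y.
    apply: (@lt_le_trans _ _ (2 * d x' x'')); first by rewrite mulr_gt0.
    by rewrite leNgt; apply/negP.
  rewrite mulrA; apply: powR_mul_le => //.
  rewrite -ler_pdivrMr ?powR_gt0// mulrAC.
  by apply: le_trans (HC3 _ _ _ Yx' Yx'' xx Yy far) _; rewrite le_max lexx orbT.
split=> [x y Yx Yy xy|eps eps0].
  exact: (cintegrable_product dm borel ups0 c0 ahlfors D0 diam s1r t1r c1 c2 C10 C20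
    K1_le K2_le).
split.
- exact: (cintegral_product_continuous dm borel ups0 c0 ahlfors D0 diam s1r t1r c1 c2 C10 C20
    K1_le K2_le).
- exact: (cintegral_product_le dm borel ups0 c0 ahlfors D0 diam s1r t1r c1 c2 C10 C20
    K1_le K2_le).
exact: (cintegral_product_holder dm borel ups0 c0 ahlfors D0 diam s1r t1r c1 c2 C10 C20
  K1_le K2_le s2'r s2''r eps0 C30 K1_holder).
Qed.
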